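(* Let $T$ be a complete first-order theory which is NATP and let $M$ be a model of $T$. If a formula $\varphi(x,a)$ Kim-divides over $M$, then it coheir-divides over $M$.
   Context: $T$ is a complete first-order $\mathcal{L}$-theory with monster model $\mathbb{M}$; tuples and small sets live in $\mathbb{M}$ and models $M$ are small elementary submodels of $\mathbb{M}$. A global type is a complete type over $\mathbb{M}$. Formulas $\varphi(x,y)$ may use parameters from the base. ATP/NATP: An $\mathcal{L}$-formula $\varphi(x,y)$ has the antichain tree property (ATP) if there is $(a_\eta)_{\eta\in 2^{<\omega}}$ such that $\{\varphi(x,a_\eta)\}_{\eta\in X}$ is consistent for every antichain $X\subseteq 2^{<\omega}$ (a set of pairwise $\subseteq$-incomparable strings), and $\{\varphi(x,a_\eta),\varphi(x,a_\nu)\}$ is inconsistent whenever $\eta\subsetneq\nu$. $T$ is NATP if no formula has ATP. A global type $p(x)$ is invariant over $M$ if $\varphi(x,b)\in p\Leftrightarrow\varphi(x,b')\in p$ whenever $b\equiv_M b'$. A type is a coheir over $M$ if it is finitely satisfiable in $M$. An invariant (respectively coheir) Morley sequence in $\mathrm{tp}(a/M)$ is a sequence $(a_i)_{i<\omega}$ for which there is a global type $p\supseteq\mathrm{tp}(a/M)$ that is invariant over $M$ (respectively a coheir over $M$) with $a_i\models p|_{Ma_{<i}}$ for all $i$. $\varphi(x,a)$ Kim-divides (respectively coheir-divides) over $M$ if there is an invariant (respectively coheir) Morley sequence $(a_i)_{i<\omega}$ in $\mathrm{tp}(a/M)$ such that $\{\varphi(x,a_i)\}_{i<\omega}$ is inconsistent.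 *)

(* Defs.v *)
From mathcomp Require Import all_boot.
From mathcomp Require Import mathcomp_extra boolp classical_sets functions cardinality.

Set Implicit Arguments.
Unset Strict Implicit.
Unset Printing Implicit Defensive.

Local Open Scope classical_set_scope.
Local Open Scope card_scope.

(** First-order syntax *)

Record signature := Signature {
  func : Type;
  reln : Type;
  func_ar : func -> nat;
  reln_ar : reln -> nat }.

Inductive term (L : signature) (V : Type) : Type :=
| Var of V
| App (f : func L) of ('I_(func_ar f) -> term L V).

Arguments Var {L V} _.
Arguments App {L V} f _.

(* [V] is the type of free variables.  In [All phi] the bound variable of
   [phi : formula L (option V)] is [None]. *)
Inductive formula (L : signature) (V : Type) : Type :=
| Bot
| Eql of term L V & term L V
| Rel (r : reln L) of ('I_(reln_ar r) -> term L V)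
| Imp of formula L V & formula L V
| All of formula L (option V).

Arguments Bot {L V}.
Arguments Eql {L V} _ _.
Arguments Rel {L V} r _.
Arguments Imp {L V} _ _.
Arguments All {L V} _.

Definition Not (L : signature) (V : Type) (phi : formula L V) : formula L V :=
  Imp phi Bot.

Definition sentence (L : signature) := formula L void.

Fixpoint trename (L : signature) (V W : Type) (g : V -> W) (t : term L V) :
    term L W :=
  match t with
  | Var v => Var (g v)
  | App f ts => App f (fun i => trename g (ts i))
  end.

Fixpoint rename (L : signature) (V W : Type) (g : V -> W) (phi : formula L V) :
    formula L W :=
  match phi with
  | Bot => Bot
  | Eql s t => Eql (trename g s) (trename g t)
  | Rel r ts => Rel r (fun i => trename g (ts i))
  | Imp phi psi => Imp (rename g phi) (rename g psi)
  | All phi => All (rename (omap g) phi)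
  end.

(* Sets of variables occurring in a term, occurring free in a formula. *)
Fixpoint tvars (L : signature) (V : Type) (t : term L V) : set V :=
  match t with
  | Var v => [set v]
  | App f ts => [set v | exists i, tvars (ts i) v]
  end.

Fixpoint fvars (L : signature) (V : Type) (phi : formula L V) : set V :=
  match phi with
  | Bot => set0
  | Eql s t => tvars s `|` tvars t
  | Rel r ts => [set v | exists i, tvars (ts i) v]
  | Imp phi psi => fvars phi `|` fvars psi
  | All phi => [set v | fvars phi (Some v)]
  end.

(** Structures and satisfaction *)

Record structure (L : signature) := Structure {
  dom :> Type;
  dom_inh : inhabited dom;
  ifunc : forall f : func L, ('I_(func_ar f) -> dom) -> dom;
  ireln : forall r : reln L, ('I_(reln_ar r) -> dom) -> Prop }.

Fixpoint eval (L : signature) (N : structure L) (V : Type) (e : V -> N)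
    (t : term L V) : N :=
  match t with
  | Var v => e v
  | App f ts => ifunc (fun i => eval e (ts i))
  end.

Definition scons (D V : Type) (d : D) (e : V -> D) : option V -> D :=
  fun o => if o is Some v then e v else d.

Fixpoint sat (L : signature) (N : structure L) (V : Type) (phi : formula L V) :
    (V -> N) -> Prop :=
  match phi with
  | Bot => fun _ => False
  | Eql s t => fun e => eval e s = eval e t
  | Rel r ts => fun e => ireln (fun i => eval e (ts i))
  | Imp phi psi => fun e => sat phi e -> sat psi e
  | All phi => fun e => forall d : N, sat phi (scons d e)
  end.

Definition holds (L : signature) (N : structure L) (s : sentence L) : Prop :=
  sat s (of_void N).

Definition is_model (L : signature) (N : structure L) (T : set (sentence L)) :
    Prop :=
  forall s, T s -> holds N s.

Definition entails (L : signature) (T : set (sentence L)) (s : sentence L) :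
    Prop :=
  forall N : structure L, is_model N T -> holds N s.

Definition complete_theory (L : signature) (T : set (sentence L)) : Prop :=
  (exists N : structure L, is_model N T) /\
  (forall s, entails T s \/ entails T (Not s)).

(** Elementary submodels *)

Definition func_closed (L : signature) (N : structure L) (M : set N) : Prop :=
  forall (f : func L) (b : 'I_(func_ar f) -> N),
    (forall i, M (b i)) -> M (ifunc b).

Definition induced (L : signature) (N : structure L) (M : set N)
    (M0 : inhabited {x : N | M x}) (Mf : func_closed M) : structure L :=
  {| dom := {x : N | M x};
     dom_inh := M0;
     ifunc := fun f b =>
       exist M (ifunc (fun i => proj1_sig (b i)))
             (Mf f (fun i => proj1_sig (b i)) (fun i => proj2_sig (b i)));
     ireln := fun r b => ireln (fun i => proj1_sig (b i)) |}.

Definition elementary_submodel (L : signature) (N : structure L) (M : set N) :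
    Prop :=
  exists (M0 : inhabited {x : N | M x}) (Mf : func_closed M),
    forall (V : Type) (phi : formula L V) (e : V -> induced M0 Mf),
      sat phi e <-> @sat L N V phi (fun v => proj1_sig (e v)).

(** Formulas with parameters and types *)

(* L(N)-formulas with free variables in [V]: the elements of [N] are
   represented as additional variables [inr c], interpreted as themselves. *)
Definition pformula (L : signature) (N : structure L) (V : Type) :=
  formula L (V + N).

Definition penv (L : signature) (N : structure L) (V : Type) (a : V -> N) :
    V + N -> N :=
  fun v => match v with inl i => a i | inr c => c end.

Definition psat (L : signature) (N : structure L) (V : Type)
    (phi : pformula N V) (a : V -> N) : Prop :=
  sat phi (penv a).

Definition formulas_over (L : signature) (N : structure L) (V : Type)
    (A : set N) : set (pformula N V) :=
  [set phi | forall c : N, fvars phi (inr c) -> A c].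

Definition no_params (L : signature) (N : structure L) (V : Type)
    (phi : formula L V) : pformula N V :=
  rename inl phi.

(* phi(x, b) *)
Definition inst (L : signature) (N : structure L) (X Y : Type)
    (phi : pformula N (X + Y)) (b : Y -> N) : pformula N X :=
  rename (fun v => match v with
                   | inl (inl x) => inl x
                   | inl (inr y) => inr (b y)
                   | inr c => inr c
                   end) phi.

Definition realizes (L : signature) (N : structure L) (V : Type) (a : V -> N)
    (p : set (pformula N V)) : Prop :=
  forall phi, p phi -> psat phi a.

Definition fin_sat_in (L : signature) (N : structure L) (V : Type) (A : set N)
    (p : set (pformula N V)) : Prop :=
  forall F : set (pformula N V), finite_set F -> F `<=` p ->
    exists c : V -> N, (forall i, A (c i)) /\ realizes c F.

(* Consistency is relative to the elementary diagram of [N]. *)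
Definition consistent (L : signature) (N : structure L) (V : Type)
    (p : set (pformula N V)) : Prop :=
  fin_sat_in setT p.

Definition complete_type (L : signature) (N : structure L) (V : Type)
    (A : set N) (p : set (pformula N V)) : Prop :=
  [/\ p `<=` @formulas_over L N V A,
      consistent p
    & forall phi, formulas_over A phi -> p phi \/ p (Not phi)].

Definition global_type (L : signature) (N : structure L) (V : Type)
    (p : set (pformula N V)) : Prop :=
  complete_type setT p.

Definition tp (L : signature) (N : structure L) (V : Type) (a : V -> N)
    (A : set N) : set (pformula N V) :=
  [set phi | formulas_over A phi /\ psat phi a].

Definition restr (L : signature) (N : structure L) (V : Type)
    (p : set (pformula N V)) (A : set N) : set (pformula N V) :=
  p `&` @formulas_over L N V A.

(** Monster models *)

(* |A| < |K| *)
Definition card_lt (D : Type) (A : set D) (K : Type) : Prop :=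
  (A #<= [set: K]) /\ ~ ([set: K] #<= A).

Definition saturated (L : signature) (N : structure L) (K : Type) : Prop :=
  forall (A : set N), card_lt A K ->
  forall (n : nat) (p : set (pformula N 'I_n)), complete_type A p ->
    exists a : 'I_n -> N, realizes a p.

Definition automorphism (L : signature) (N : structure L) (s : N -> N) : Prop :=
  [/\ bijective s,
      forall (f : func L) (b : 'I_(func_ar f) -> N),
        s (ifunc b) = ifunc (fun i => s (b i))
    & forall (r : reln L) (b : 'I_(reln_ar r) -> N),
        ireln b <-> ireln (fun i => s (b i))].

(* Only the values of [f] on [A] matter. *)
Definition partial_elementary (L : signature) (N : structure L) (A : set N)
    (f : N -> N) : Prop :=
  forall (V : Type) (phi : formula L V) (e : V -> N), (forall v, A (e v)) ->
    (sat phi e <-> sat phi (fun v => f (e v))).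

Definition strongly_homogeneous (L : signature) (N : structure L) (K : Type) :
    Prop :=
  forall (A : set N) (f : N -> N), card_lt A K -> partial_elementary A f ->
    exists2 s : N -> N, automorphism s & forall c, A c -> s c = f c.

(* For kappa = |K|: kappa > |L| + aleph_0, and [N] is kappa-saturated and
   strongly kappa-homogeneous.  Small means of cardinality < kappa. *)
Definition monster (L : signature) (N : structure L) (K : Type) : Prop :=
  [/\ card_lt [set: nat] K,
      card_lt [set: func L] K /\ card_lt [set: reln L] K,
      saturated N K
    & strongly_homogeneous N K].

(** The antichain tree property *)

Definition antichain (X : set (seq bool)) : Prop :=
  forall eta nu, X eta -> X nu -> eta <> nu -> ~~ prefix eta nu.

Definition ATP (L : signature) (N : structure L) (n m : nat)
    (phi : formula L ('I_n + 'I_m)) : Prop :=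
  exists a : seq bool -> 'I_m -> N,
    (forall X : set (seq bool), antichain X ->
       consistent [set inst (no_params N phi) (a eta) | eta in X]) /\
    (forall eta nu : seq bool, prefix eta nu -> eta <> nu ->
       ~ consistent [set inst (no_params N phi) (a eta);
                         inst (no_params N phi) (a nu)]).

(* To be used with [N] the monster model of the theory. *)
Definition NATP (L : signature) (N : structure L) : Prop :=
  forall (n m : nat) (phi : formula L ('I_n + 'I_m)), ~ ATP N phi.

(** Morley sequences, Kim-dividing and coheir-dividing *)

Definition invariant_over (L : signature) (N : structure L) (V : Type)
    (M : set N) (p : set (pformula N V)) : Prop :=
  forall (m : nat) (phi : pformula N (V + 'I_m)), formulas_over M phi ->
  forall b b' : 'I_m -> N, tp b M = tp b' M ->
    (p (inst phi b) <-> p (inst phi b')).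

Definition coheir_over (L : signature) (N : structure L) (V : Type) (M : set N)
    (p : set (pformula N V)) : Prop :=
  fin_sat_in M p.

(* M together with the entries of a_j, j < i *)
Definition with_initial (L : signature) (N : structure L) (V : Type)
    (M : set N) (s : nat -> V -> N) (i : nat) : set N :=
  M `|` [set c | exists j v, (j < i)%N /\ c = s j v].

Definition morley_seq_of (L : signature) (N : structure L) (V : Type)
    (M : set N) (p : set (pformula N V)) (s : nat -> V -> N) : Prop :=
  forall i, realizes (s i) (restr p (with_initial M s i)).

Definition invariant_morley_seq (L : signature) (N : structure L) (V : Type)
    (M : set N) (a : V -> N) (s : nat -> V -> N) : Prop :=
  exists p : set (pformula N V),
    [/\ global_type p, tp a M `<=` p, invariant_over M p & morley_seq_of M p s].

Definition coheir_morley_seq (L : signature) (N : structure L) (V : Type)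
    (M : set N) (a : V -> N) (s : nat -> V -> N) : Prop :=
  exists p : set (pformula N V),
    [/\ global_type p, tp a M `<=` p, coheir_over M p & morley_seq_of M p s].

Definition Kim_divides (L : signature) (N : structure L) (X Y : Type)
    (M : set N) (phi : pformula N (X + Y)) (a : Y -> N) : Prop :=
  exists2 s : nat -> Y -> N, invariant_morley_seq M a s
    & ~ consistent [set inst phi (s i) | i in [set: nat]].

Definition coheir_divides (L : signature) (N : structure L) (X Y : Type)
    (M : set N) (phi : pformula N (X + Y)) (a : Y -> N) : Prop :=
  exists2 s : nat -> Y -> N, coheir_morley_seq M a s
    & ~ consistent [set inst phi (s i) | i in [set: nat]].

(* Main.v *)
Require Import Defs.
From HB Require Import structures.
From mathcomp Require Import all_boot.
From mathcomp Require Import mathcomp_extra boolp classical_sets functions cardinality filter.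

(** Suppose that [phi(x, a)] divides along an invariant Morley sequence [s]
    over [M], in a type [p], but along no coheir Morley sequence.  The idea is
    to build trees of copies of [a] in which the nodes of every branch, read
    from the leaf to the root, look like an initial segment of [s], while the
    nodes of every antichain look like a Morley sequence in one fixed coheir.
    Long branches are then inconsistent and antichains are consistent, which is
    the antichain tree property up to replacing [phi] by a conjunction.

    Coheirs are handled as ultrafilters on tuples of [M], and Morley sequences
    of coheirs as iterated products of these ultrafilters ([product]).  This
    turns the construction into combinatorics of filters, and all the trees
    live in [M].  Invariance of [p] provides a common root for finitely many
    chains that look like segments of [s] ([common_root]).

    A tower is a linearly ordered family of levels together with the type (an
    ultrafilter) of a chain meeting any finite set of levels, such that trees
    all of whose branches have this type exist; the subtrees below a node are
    generic over each other, so that antichains of chains get iterated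
    products of chain types ([follows_antichain]).  A new level can always be
    put on top ([extension_tower]).  The point is to give all new chains of
    the same levels the same type: the sets of (root, chain) that occur along
    all branches of arbitrarily branching trees form a partition regular
    family, by a Ramsey argument for trees ([forests_dichotomy]), hence
    contain an ultrafilter.  The ultrafilters of the successive levels may
    change, but they are elements of a fixed set, and a maximal tower (Zorn)
    in which a level is an ultrafilter with a label must use one ultrafilter
    [q] with all labels ([constant_tower]).  On the levels labelled by [q],
    antichains of nodes are Morley sequences in the coheir [q], so they are
    consistent.

    It remains to make comparable nodes inconsistent in pairs.  Fix blocks of
    [l] consecutive levels and replace nodes by chains meeting one block.  For
    [l = 1] all antichains are consistent, for large [l] no chain is.  Take
    [l] a power of two with the first behaviour such that [2 l] fails: there
    are numbers [c] and [r] such that any [c] blocks of size [2 l], repeated [r]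
    times, are inconsistent.  Putting side by side one tree for each block of
    such a sequence, and cutting each block into two halves of size [l] placed
    at two comparable nodes, gives finite trees of bounded tuples in which
    antichains are consistent and comparable pairs are not
    ([compatible_blocks_step]).  Compactness yields the antichain tree property
    for a conjunction of instances of [phi] ([ATP_of_patterns]). *)

Set Implicit Arguments.
Unset Strict Implicit.
Unset Printing Implicit Defensive.

Local Open Scope classical_set_scope.
Local Open Scope card_scope.

(** * Iterated products of filters, and trees *)

Lemma filterI_ex (T : Type) (F : set_system T) (D E : set T) :
  ProperFilter F -> F D -> F E -> exists x, D x /\ E x.
Proof. by move=> pF FD FE; exact: filter_ex (filterI FD FE). Qed.

Lemma ultra_decide (T : Type) (F : set_system T) :
  ProperFilter F -> (forall A, F A \/ F (~` A)) -> UltraFilter F.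
Proof.
move=> FF dec; split=> // G GG FG; apply/seteqP; split=> [A GA|]; last exact: FG.
case: (dec A) => // /FG GnA.
by have [x []] := filterI_ex GG GA GnA.
Qed.

Lemma filter_all (T : Type) (I : eqType) (F : set_system T) (r : seq I)
    (D : I -> set T) :
  Filter F -> {in r, forall i, F (D i)} ->
  F [set x | {in r, forall i, D i x}].
Proof.
move=> FF; elim: r => [|i r IH] rD; first by apply: filterE => x j.
have FDi := rD _ (mem_head _ _).
have FDr : F [set x | {in r, forall i, D i x}].
  by apply: IH => j jr; apply: rD; rewrite in_cons jr orbT.
apply: filterS (filterI FDi FDr) => x [Di Dr] j.
by rewrite in_cons => /orP[/eqP -> //|/Dr].
Qed.

Section Products.
Variable X : Type.
Implicit Types (f : set_system X) (fs : seq (set_system X)).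

(** The first factor is the outermost quantifier.  For ultrafilters on tuples of
    a model this is the product of the coheirs that they define, with the
    latest element of the Morley sequence at the head of the list: a coheir
    quantifies over elements of the model, so the latest element can be fixed
    before the earlier ones. *)
Fixpoint product fs : set_system (seq X) :=
  if fs is f :: fs' then fun D => f (fun x => product fs' (fun l => D (x :: l)))
  else fun D => D [::].

Lemma product_filter fs :
  {in fs, forall f, Filter f} -> Filter (product fs).
Proof.
elim: fs => [|f fs IH] fsF.
  by split; [|move=> D E D0 E0; split|move=> D E DE /DE].
have fF : Filter f by apply: fsF; rewrite mem_head.
have {}IH : Filter (product fs).
  by apply: IH => g gs; apply: fsF; rewrite in_cons gs orbT.
split => /=.
- by apply: filterE => x; apply: (filterT (F := product fs)).
- move=> D E fD fE; apply: filterS (filterI fD fE) => x [Dx Ex].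
  exact: (filterI (F := product fs)).
- move=> D E DE; apply: filterS => x; apply: filterS => l; exact: DE.
Qed.

Lemma product_proper fs :
  {in fs, forall f, ProperFilter f} -> ProperFilter (product fs).
Proof.
move=> fsF; split; last first.
  by apply: product_filter => f /fsF[].
elim: fs fsF => [|f fs IH] fsF //= f0.
have fF : ProperFilter f by apply: fsF; rewrite mem_head.
have /filter_ex [x] := f0.
by apply: IH => g gs; apply: fsF; rewrite in_cons gs orbT.
Qed.

Lemma product_ultra fs D :
  {in fs, forall f, UltraFilter f} -> product fs D \/ product fs (~` D).
Proof.
elim: fs D => [|f fs IH] D fsF /=; first exact: EM.
have fF : UltraFilter f by apply: fsF; rewrite mem_head.
have [fD|fD] := in_ultra_setVsetC [set x | product fs (fun l => D (x :: l))] fF.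
  by left.
right; apply: filterS fD => x /= nD.
have gF : {in fs, forall f, UltraFilter f}.
  by move=> g gs; apply: fsF; rewrite in_cons gs orbT.
by have [//|] := IH (fun l => D (x :: l)) gF.
Qed.

Lemma product_cat fs gs D :
  product (fs ++ gs) D = product fs (fun l => product gs (fun l' => D (l ++ l'))).
Proof. by elim: fs D => //= f fs IH D; congr f; apply/funext => x; rewrite IH. Qed.

Lemma productS fs D E : {in fs, forall f, Filter f} ->
  D `<=` E -> product fs D -> product fs E.
Proof. by move=> /product_filter fsF; exact: filterS. Qed.

Lemma product_size fs : {in fs, forall f, Filter f} ->
  product fs [set l | size l = size fs].
Proof.
elim: fs => [//|f fs IH] fsF /=.
have fF : Filter f by apply: fsF; rewrite mem_head.
apply: filterE => x.
have gF : {in fs, forall f, Filter f}.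
  by move=> g gs; apply: fsF; rewrite in_cons gs orbT.
by apply: productS (IH gF) => // l /= ->.
Qed.

End Products.

Lemma product_nseq_all (X : eqType) (f : set_system X) N (D : set X) : Filter f ->
  f D -> product (nseq N f) [set l | {in l, forall x, D x}].
Proof.
move=> fF fD; have NF k : {in nseq k f, forall g, Filter g}.
  by move=> g /nseqP[->].
elim: N => [|N IH] //=; apply: filterS fD => x Dx.
by apply: productS IH => // l Dl y; rewrite in_cons => /orP[/eqP->|/Dl].
Qed.

(** Arity and height are left out of the type; generic trees satisfy [full]. *)
Inductive tree (A : Type) := Node of A & seq (tree A).
HB.instance Definition _ (A : Type) := gen_eqMixin (tree A).

Definition label (A : Type) (t : tree A) := let: Node a _ := t in a.
Definition children (A : Type) (t : tree A) := let: Node _ ts := t in ts.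

Fixpoint branches (A : Type) (n : nat) (f : seq (tree A)) : seq (seq A) :=
  if n is n'.+1 then [seq label t :: pi | t <- f, pi <- branches n' (children t)]
  else [:: [::]].

Lemma branches_size (A : eqType) n (f : seq (tree A)) :
  {in branches n f, forall pi, size pi = n}.
Proof.
elim: n f => [|n IH] f pi /=; first by rewrite inE => /eqP ->.
by move=> /allpairsPdep[t [pi' [_ /IH <- ->]]].
Qed.

Lemma branches_sub (A : eqType) n (f g : seq (tree A)) :
  {subset f <= g} -> {subset branches n f <= branches n g}.
Proof.
case: n => [|n] fg pi //= /allpairsPdep[t [pi' [tf bpi ->]]].
by apply/allpairsPdep; exists t, pi'; rewrite fg.
Qed.

Section Forests.
Variables (A Lev : eqType) (R : seq Lev -> set_system (seq A)).

(** A root is attached to a generic forest in such a way that every branch through it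
    has type [r]: the types of the branches are prescribed, the type of the
    whole tree is left open. *)
Definition tree_step (r : set_system (seq A)) (n : nat)
    (E : set_system (seq (tree A))) : set_system (tree A) :=
  [set D | exists E0 C, [/\ E E0, r C &
     forall z f, E0 f -> {in branches n f, forall pi, C (z :: pi)} -> D (Node z f)]].

(** Generic forests of [N]-branching trees with levels [F], root first: the
    trees of a forest are generic over each other, as in a Morley sequence. *)
Fixpoint forests (N : nat) (F : seq Lev) : set_system (seq (tree A)) :=
  if F is s :: F' then
    product (nseq N (tree_step (R F) (size F') (forests N F')))
  else fun D => D [::].

Definition trees (N : nat) (F : seq Lev) : set_system (tree A) :=
  if F is s :: F' then tree_step (R F) (size F') (forests N F') else setT.

Lemma forests_cons N s F : forests N (s :: F) = product (nseq N (trees N (s :: F))).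
Proof. by []. Qed.

Lemma treesE N s F D : trees N (s :: F) D <->
  exists E0 C, [/\ forests N F E0, R (s :: F) C &
     forall z f, E0 f -> {in branches (size F) f, forall pi, C (z :: pi)} -> D (Node z f)].
Proof. by []. Qed.

Lemma tree_step_filter r n E : Filter r -> Filter E -> Filter (tree_step r n E).
Proof.
move=> rF EF; split.
- by exists setT, setT; split=> //; apply: filterT.
- move=> D1 D2 [E1 [C1 [E1E C1r H1]]] [E2 [C2 [E2E C2r H2]]].
  exists (E1 `&` E2), (C1 `&` C2); split; [exact: filterI|exact: filterI|].
  move=> z f [E1f E2f] Hp; split; [apply: H1 => // pi|apply: H2 => // pi];
  by move=> /Hp [].
- move=> D1 D2 D12 [E0 [C [E0E Cr H]]]; exists E0, C; split=> // z f E0f Hp.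
  exact/D12/H.
Qed.

End Forests.

Lemma forests_ext (A Lev : eqType) (R R' : seq Lev -> set_system (seq A)) N F :
  (forall G, suffix G F -> R G = R' G) -> forests R N F = forests R' N F.
Proof.
elim: F => //= s F IH RR; rewrite RR ?suffix_refl //.
by rewrite IH // => G GF; apply/RR/(suffix_trans GF)/suffix_cons.
Qed.

(** * A Ramsey dichotomy for generic forests *)

Section Ramsey.
Variable A : eqType.

(** Finite lists of candidates are chosen before the coloring is known.  A
    statement giving one candidate for each coloring would not survive the
    induction on the number of trees, because the remaining trees have to be
    generic over all the candidates at once. *)
Definition dichotomy n (E1 E2 : set (seq (tree A))) : set (seq (tree A)) :=
  [set f | exists L1 L2 : seq (seq (tree A)), [/\
    {in L1, forall g, E1 g /\ {subset branches n g <= branches n f}},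
    {in L2, forall g, E2 g /\ {subset branches n g <= branches n f}}
  & forall kappa : pred (seq A),
     (exists2 g, g \in L1 & {in branches n g, forall pi, kappa pi}) \/
     (exists2 g, g \in L2 & {in branches n g, forall pi, ~~ kappa pi})]].

Lemma branches_cat n (f g : seq (tree A)) :
  branches n.+1 (f ++ g) = branches n.+1 f ++ branches n.+1 g.
Proof. by rewrite /= map_cat flatten_cat. Qed.

Lemma branches_cons n t (f : seq (tree A)) :
  branches n.+1 (t :: f) = branches n.+1 [:: t] ++ branches n.+1 f.
Proof. by rewrite /= cats0. Qed.

(** Pigeonhole for the trees of a forest: with [N1 + N2] trees, each of which
    contains a subtree of the first kind or a subtree of the second kind, one
    finds [N1] of the first kind or [N2] of the second kind. *)
Lemma dichotomy_product n (T1 T2 T : set_system (tree A)) :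
  Filter T1 -> Filter T2 -> Filter T ->
  (forall D1 D2 : set (tree A), T1 D1 -> T2 D2 ->
    T [set t | dichotomy n.+1 [set [:: u] | u in D1] [set [:: u] | u in D2] [:: t]]) ->
  forall N1 N2 E1 E2, product (nseq N1 T1) E1 -> product (nseq N2 T2) E2 ->
    product (nseq (N1 + N2) T) (dichotomy n.+1 E1 E2).
Proof.
move=> T1F T2F TF TD.
have NF (f : set_system (tree A)) k : Filter f -> Filter (product (nseq k f)).
  by move=> fF; apply: product_filter => g /nseqP[->].
move=> N1 N2; move: {2}(N1 + N2)%N (erefl (N1 + N2)%N) => k.
elim: k N1 N2 => [|k IH] [|a] [|b] //.
- move=> _ E1 E2 E10 E20; exists [:: [::]], [::]; split=> //.
    by move=> g; rewrite inE => /eqP ->.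
  by move=> kappa; left; exists [::].
- move=> _ E1 E2 E10 E20; apply: filterE => f; exists [:: [::]], [::]; split=> //.
    by move=> g; rewrite inE => /eqP ->.
  by move=> kappa; left; exists [::].
- move=> _ E1 E2 E10 E20; apply: filterE => f; exists [::], [:: [::]]; split=> //.
    by move=> g; rewrite inE => /eqP ->.
  by move=> kappa; right; exists [::].
rewrite addSn => -[abk] E1 E2 /= T1E1 T2E2.
apply: filterS (TD _ _ T1E1 T2E2) => t [L1 [L2 [L1P L2P Lk]]].
have H1 : product (nseq k T) [set f | {in L1, forall g,
    dichotomy n.+1 (fun l => E1 (g ++ l)) E2 f}].
  apply: filter_all => g /L1P[[u T1u <-] _].
  by rewrite -abk; apply: IH.
have H2 : product (nseq k T) [set f | {in L2, forall g,
    dichotomy n.+1 E1 (fun l => E2 (g ++ l)) f}].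
  have abk' : (a.+1 + b = k)%N by rewrite -abk addnS.
  apply: filter_all => g /L2P[[u T2u <-] _].
  by rewrite -abk'; apply: IH.
rewrite abk; apply: filterS (filterI H1 H2) => f [/= h1 h2].
have sub_t g g' : {subset branches n.+1 g <= branches n.+1 [:: t]} ->
    {subset branches n.+1 g' <= branches n.+1 f} ->
    {subset branches n.+1 (g ++ g') <= branches n.+1 (t :: f)}.
  move=> gt gf pi; rewrite branches_cons mem_cat.
  rewrite branches_cat mem_cat => /orP[/gt->//|/gf->]; exact: orbT.
have sub_f g : {subset branches n.+1 g <= branches n.+1 f} ->
    {subset branches n.+1 g <= branches n.+1 (t :: f)}.
  by move=> gf pi /gf; rewrite branches_cons mem_cat orbC => ->.
pose D1 g (c : seq (seq (tree A)) * seq (seq (tree A))) := g \in L1 ->  [/\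
    {in c.1, forall h, E1 (g ++ h) /\ {subset branches n.+1 h <= branches n.+1 f}},
    {in c.2, forall h, E2 h /\ {subset branches n.+1 h <= branches n.+1 f}}
  & forall kappa : pred (seq A),
     (exists2 h, h \in c.1 & {in branches n.+1 h, forall pi, kappa pi}) \/
     (exists2 h, h \in c.2 & {in branches n.+1 h, forall pi, ~~ kappa pi})].
have [c1 c1P] : {c1 & forall g, D1 g (c1 g)}.
  apply: (@choice _ _ D1) => g; rewrite /D1; have [gL|gL] := boolP (g \in L1).
    by have [M1 [M2 [M1P M2P MP]]] := h1 _ gL; exists (M1, M2).
  by exists ([::], [::]).
pose D2 g (c : seq (seq (tree A)) * seq (seq (tree A))) := g \in L2 ->  [/\
    {in c.1, forall h, E1 h /\ {subset branches n.+1 h <= branches n.+1 f}},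
    {in c.2, forall h, E2 (g ++ h) /\ {subset branches n.+1 h <= branches n.+1 f}}
  & forall kappa : pred (seq A),
     (exists2 h, h \in c.1 & {in branches n.+1 h, forall pi, kappa pi}) \/
     (exists2 h, h \in c.2 & {in branches n.+1 h, forall pi, ~~ kappa pi})].
have [c2 c2P] : {c2 & forall g, D2 g (c2 g)}.
  apply: (@choice _ _ D2) => g; rewrite /D2; have [gL|gL] := boolP (g \in L2).
    by have [M1 [M2 [M1P M2P MP]]] := h2 _ gL; exists (M1, M2).
  by exists ([::], [::]).
exists ([seq g ++ h | g <- L1, h <- (c1 g).1] ++ [seq h | g <- L2, h <- (c2 g).1]).
exists ([seq h | g <- L1, h <- (c1 g).2] ++ [seq g ++ h | g <- L2, h <- (c2 g).2]).
split.
- move=> g'; rewrite mem_cat => /orP[|] /allpairsPdep[g [h [gL hg ->]]].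
    have [/(_ _ hg)[E1gh sh] _ _] := c1P _ gL; split=> //.
    by apply: sub_t => //; have [_] := L1P _ gL.
  by have [/(_ _ hg)[E1gh sh] _ _] := c2P _ gL; split=> //; exact: sub_f.
- move=> g'; rewrite mem_cat => /orP[|] /allpairsPdep[g [h [gL hg ->]]].
    by have [_ /(_ _ hg)[E1gh sh] _] := c1P _ gL; split=> //; exact: sub_f.
  have [_ /(_ _ hg)[E1gh sh] _] := c2P _ gL; split=> //.
  by apply: sub_t => //; have [_] := L2P _ gL.
move=> kappa; have [[g gL gk]|[g gL gk]] := Lk kappa.
  have [_ _ /(_ kappa)[[h hc hk]|[h hc hk]]] := c1P _ gL; [left|right].
    exists (g ++ h); first by rewrite mem_cat; apply/orP; left; apply/allpairsPdep; exists g, h.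
    by move=> pi; rewrite branches_cat mem_cat => /orP[/gk|/hk].
  by exists h => //; rewrite mem_cat; apply/orP; left; apply/allpairsPdep; exists g, h.
have [_ _ /(_ kappa)[[h hc hk]|[h hc hk]]] := c2P _ gL; [left|right].
  by exists h => //; rewrite mem_cat; apply/orP; right; apply/allpairsPdep; exists g, h.
exists (g ++ h); first by rewrite mem_cat; apply/orP; right; apply/allpairsPdep; exists g, h.
by move=> pi; rewrite branches_cat mem_cat => /orP[/gk|/hk].
Qed.

End Ramsey.

Section Coherent.
Variables (A Lev : eqType) (R : seq Lev -> set_system (seq A)).

(** [R F] is the type of a chain with levels [F].  The lists of
    levels that are present are those with [R F setT]. *)
Record coherent : Prop := Coherent {
  coh_ultra : forall F, R F setT -> UltraFilter (R F);
  coh_mask : forall F m, R F setT ->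
    forall C, R (mask m F) C <-> R F [set pi | C (mask m pi)];
  coh_size : forall F, R F setT -> R F [set pi | size pi = size F] }.

Hypothesis cR : coherent.
Local Notation dom F := (R F setT).

Lemma dom_filter F : dom F -> ProperFilter (R F).
Proof. by move=> /(coh_ultra cR)[]. Qed.

Lemma dom_mask F m : dom F -> dom (mask m F).
Proof. by move=> dF; apply/(coh_mask cR). Qed.

Lemma dom_subseq F G : subseq G F -> dom F -> dom G.
Proof. by move=> /subseqP[m _ ->]; exact: dom_mask. Qed.

Lemma dom_suffix F G : suffix G F -> dom F -> dom G.
Proof. by move=> /suffixP[s ->]; apply: dom_subseq; exact: suffix_subseq. Qed.

Lemma dom_cons s F : dom (s :: F) -> dom F.
Proof. by apply: dom_suffix; exact: suffix_cons. Qed.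

Lemma dom_nil C : dom [::] -> R [::] C -> C [::].
Proof.
move=> d0 RC; have := dom_filter d0 => pF.
by have [pi [/size0nil ->]] := filterI_ex pF (coh_size cR d0) RC.
Qed.

Lemma forests_filter N F : dom F -> Filter (forests R N F).
Proof.
elim: F => [_|s F IH dF]; first by split; [|move=> D E D0 E0; split|move=> D E DE /DE].
rewrite forests_cons; apply: product_filter => g /nseqP[-> _].
have ? := dom_filter dF.
by apply: tree_step_filter; apply: IH; exact: dom_cons dF.
Qed.

Lemma trees_filter N F : dom F -> Filter (trees R N F).
Proof.
case: F => [_|s F dF]; first exact: filter_setT.
have ? := dom_filter dF.
by apply: tree_step_filter; apply: forests_filter; exact: dom_cons dF.
Qed.

Lemma trees_branches N s F C : dom (s :: F) -> R (s :: F) C ->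
  trees R N (s :: F) [set t | {in branches (size F).+1 [:: t], forall pi, C pi}].
Proof.
move=> dF RC; have fF := forests_filter N (dom_cons dF).
exists setT, C; split=> //; first exact: filterT.
by move=> z f _ zC pi; rewrite /= cats0 => /mapP[pi' /zC ? ->].
Qed.

Lemma forests_branches N F C : dom F -> R F C ->
  forests R N F [set f | {in branches (size F) f, forall pi, C pi}].
Proof.
case: F => [dF RC|s F dF RC] /=.
  by move=> pi; rewrite inE => /eqP ->; exact: dom_nil.
have tF := trees_filter N dF.
have := product_nseq_all N tF (trees_branches N dF RC).
apply: productS => [g /nseqP[->]//|l Dl pi /allpairsPdep[t [pi' [tl bpi ->]]]].
by apply: (Dl _ tl); rewrite /= cats0 map_f.
Qed.

(** Ramsey for trees: if the branches of a generic [N1 + N2]-branching forest are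
    colored with two colors, it contains a generic [N1]-branching subforest of
    the first color or a generic [N2]-branching one of the second color. *)
Lemma forests_dichotomy N1 N2 F E1 E2 : dom F ->
  forests R N1 F E1 -> forests R N2 F E2 ->
  forests R (N1 + N2) F (dichotomy (size F) E1 E2).
Proof.
elim: F E1 E2 => [|s F IH] E1 E2 dF FE1 FE2.
  exists [:: [::]], [:: [::]]; split.
  - by move=> g; rewrite inE => /eqP ->; split=> //; exact: FE1.
  - by move=> g; rewrite inE => /eqP ->; split=> //; exact: FE2.
  move=> kappa; case kn : (kappa [::]); [left|right]; exists [::] => // pi;
    by rewrite inE => /eqP ->; rewrite kn.
have tF N := trees_filter N dF.
have pF := dom_filter dF.
apply: dichotomy_product FE1 FE2 => D1 D2.
move=> /treesE [G1 [C1 [fG1 rC1 H1]]] /treesE [G2 [C2 [fG2 rC2 H2]]].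
exists (dichotomy (size F) G1 G2), (C1 `&` C2); split.
- exact: IH (dom_cons dF) fG1 fG2.
- exact: filterI.
move=> z f [L1 [L2 [L1P L2P Lk]]] zC.
exists [seq [:: Node z g] | g <- L1], [seq [:: Node z g] | g <- L2]; split.
- move=> g' /mapP[g gL ->]; have [Gg sg] := L1P _ gL; split.
    by exists (Node z g) => //; apply: H1 => // pi /sg/zC[].
  move=> pi; rewrite /= !cats0 => /mapP[pi' /sg bpi' ->]; exact: map_f.
- move=> g' /mapP[g gL ->]; have [Gg sg] := L2P _ gL; split.
    by exists (Node z g) => //; apply: H2 => // pi /sg/zC[].
  move=> pi; rewrite /= !cats0 => /mapP[pi' /sg bpi' ->]; exact: map_f.
move=> kappa; have [[g gL gk]|[g gL gk]] := Lk (fun pi => kappa (z :: pi)); [left|right];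
  (exists [:: Node z g]; [exact: (map_f (fun g => [:: Node z g]))|]);
  by move=> pi; rewrite /= cats0 => /mapP[pi' /gk ? ->].
Qed.

End Coherent.

(** * Deleting levels of generic forests *)

Fixpoint full (A : Type) (N n : nat) (f : seq (tree A)) : bool :=
  if n is n'.+1 then (size f == N) && all (fun t => full N n' (children t)) f
  else true.

Lemma full_branches A N n (f : seq (tree A)) :
  full N n f -> size (branches n f) = (N ^ n)%N.
Proof.
elim: n f => [//|n IH] f /= /andP[/eqP sf]; rewrite expnS -{2}sf {sf}.
elim: f => [//|t f IHf] /= /andP[/IH st /IHf {}IHf].
by rewrite size_cat size_map IHf st mulSn.
Qed.

Lemma product_transfer (X : eqType) (T1 T2 : set_system X) (B : X -> X -> Prop) :
  Filter T2 ->
  (forall D, T1 D -> T2 [set t | exists2 u, D u & B u t]) ->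
  forall N E, product (nseq N T1) E ->
    product (nseq N T2) [set f | exists2 g, E g & {in g, forall u, exists2 t, t \in f & B u t}].
Proof.
move=> T2F T12; elim=> [|N IH] E /=; first by exists [::].
have NF : Filter (product (nseq N T2)) by apply: product_filter => ? /nseqP[->].
move=> /T12; apply: filterS => t [u /IH Eu Bu]; apply: filterS Eu => f [g Eg Bg].
exists (u :: g) => // v; rewrite in_cons => /orP[/eqP ->|/Bg[w wf Bv]].
  by exists t => //; exact: mem_head.
by exists w => //; rewrite in_cons wf orbT.
Qed.

Section Deletion.
Variables (A Lev : eqType) (R : seq Lev -> set_system (seq A)).
Hypothesis cR : coherent R.
Local Notation dom F := (R F setT).

Lemma forests_full N F : dom F -> forests R N F [set f | full N (size F) f].
Proof.
elim: F => [//|s F IH dF]; rewrite forests_cons.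
have tF := trees_filter cR N dF.
have tfull : trees R N (s :: F) [set t | full N (size F) (children t)].
  exists [set f | full N (size F) f], setT; split=> //.
  exact: IH (dom_cons cR dF).
have NF : {in nseq N (trees R N (s :: F)), forall g, Filter g} by move=> g /nseqP[->].
have nF := product_filter NF.
have H := @filterI _ _ nF _ _ (product_nseq_all N tF tfull) (product_size NF).
apply: filterS H => f [fch /= sf].
rewrite sf size_nseq eqxx /=; apply/allP => t /fch; exact.
Qed.

(** A level of a generic tree is deleted by keeping only the first child of the
    nodes above it. *)
Lemma forests_mask N F m E : (0 < N)%N -> dom F -> size m = size F ->
  forests R N (mask m F) E ->
  forests R N F [set f | exists2 g, E g & {in branches (size (mask m F)) g,
     forall pi', exists2 pi, pi \in branches (size F) f & pi' = mask m pi}].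
Proof.
move=> N0; elim: F m E => [|s F IH] [|b m] //= E dF.
  by move=> _ E0; exists [::] => // pi; rewrite inE => /eqP ->; exists [::] => //.
move=> [sm]; have dF' := dom_cons cR dF.
have tF := trees_filter cR N dF.
case: b => [|FE]; last first.
  have TE : trees R N (s :: F) [set t | exists2 g, E g & {in branches (size (mask m F)) g,
     forall pi', exists2 pi, pi \in branches (size F) (children t) & pi' = mask m pi}].
    exists [set f | exists2 g, E g & {in branches (size (mask m F)) g,
     forall pi', exists2 pi, pi \in branches (size F) f & pi' = mask m pi}], setT; split=> //.
    exact: IH.
  case: N N0 tF TE {FE IH} => // N _ tF TE.
  apply: (@filterS _ _ tF _ _ _ TE) => t [g Eg gt].
  have NF : {in nseq N (trees R N.+1 (s :: F)), forall g, Filter g} by move=> h /nseqP[->].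
  have nF := product_filter NF; apply: filterE => f.
  exists g => // pi' /gt[pi pit ->]; exists (label t :: pi) => //.
  by rewrite mem_cat map_f.
rewrite !forests_cons => TE.
have tr := @product_transfer _ (trees R N (s :: mask m F)) (trees R N (s :: F))
  (fun u t => {in branches (size (mask m F)).+1 [:: u], forall pi',
     exists2 pi, pi \in branches (size F).+1 [:: t] & pi' = mask (true :: m) pi}) tF.
have /tr : forall D, trees R N (s :: mask m F) D -> trees R N (s :: F)
  [set t | exists2 u, D u & {in branches (size (mask m F)).+1 [:: u], forall pi',
     exists2 pi, pi \in branches (size F).+1 [:: t] & pi' = mask (true :: m) pi}].
  move=> D /treesE[E0 [C [/(IH _ _ dF' sm) fE0 RC H]]].
  exists [set f | exists2 g, E0 g & {in branches (size (mask m F)) g,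
    forall pi', exists2 pi, pi \in branches (size F) f & pi' = mask m pi}].
  exists [set pi | C (mask (true :: m) pi)]; split; first exact: fE0.
    by apply/(coh_mask cR (true :: m) dF).
  move=> z f [g E0g gf] zC; exists (Node z g).
    by apply: H => // pi /gf[pi' /zC /= ? ->].
  move=> pi; rewrite /= cats0 => /mapP[pi' /gf[pi0 bpi0 ->] ->].
  by exists (z :: pi0); rewrite // cats0 map_f.
move=> /(_ _ _ TE); apply: filterS.
  by apply: product_filter => ? /nseqP[->].
move=> f [g Eg gf]; exists g => // pi' /allpairsPdep[u [pi [ug bpi ->]]].
have [t tf /(_ (label u :: pi))[]] := gf _ ug; first by rewrite /= cats0 map_f.
move=> pi0; rewrite /= cats0 => /mapP[pi1 bpi1 -> ->].
exists (label t :: pi1) => //; apply/allpairsPdep; by exists t, pi1.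
Qed.

End Deletion.

(** * Adding a level on top of a tower *)

(** What is used of the types [P n] of the [n]-element segments of a fixed
    Morley sequence in an invariant type, latest element first.  The field
    [chain_root] is where invariance enters. *)
Record chain_filters (A : eqType) (P : nat -> set_system (seq A)) : Prop :=
  ChainFilters {
    chain_filter : forall n, Filter (P n);
    chain_size : forall n, P n [set pi | size pi = n];
    chain_nil : forall C, P 0 C -> C [::];
    chain_mask : forall m C, P (count id m) C ->
      P (size m) [set pi | C (mask m pi)];
    chain_root : forall n K C, P n.+1 C -> exists2 D, P n D &
      forall pis : seq (seq A), (size pis <= K)%N -> {in pis, forall pi, D pi} ->
      exists z, {in pis, forall pi, C (z :: pi)} }.

(** A level is the ultrafilter of its nodes with a label; labels allow several levels
    to have the same ultrafilter. *)
Notation level A := (set (set A) * nat)%type.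

Record tower (A : eqType) (P : nat -> set_system (seq A))
    (R : seq (level A) -> set_system (seq A)) : Prop := Tower {
  tower_coherent :> coherent R;
  tower_dom : forall F C, R F C -> R F setT;
  tower_dir : forall F G, R F setT -> R G setT ->
    exists H, [/\ R H setT, subseq F H & subseq G H];
  tower_uniq : forall F, R F setT -> uniq F;
  tower_level : forall s C, R [:: s] setT -> R [:: s] C <-> s.1 [set z | C [:: z]];
  tower_chain : forall F, R F setT -> P (size F) `<=` R F;
  tower_good : forall F N, R F setT -> (0 < N)%N -> F <> [::] -> ~ trees R N F set0 }.

Lemma trees_ext (A Lev : eqType) (R R' : seq Lev -> set_system (seq A)) N F :
  (forall G, suffix G F -> R G = R' G) -> trees R N F = trees R' N F.
Proof.
case: F => //= s F RR; rewrite RR ?suffix_refl // (@forests_ext _ _ R R') //.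
by move=> G GF; apply/RR/(suffix_trans GF)/suffix_cons.
Qed.

Section Extension.
Variables (A : eqType) (P : nat -> set_system (seq A)).
Hypothesis bP : chain_filters P.
Variable R : seq (level A) -> set_system (seq A).
Hypothesis tR : tower P R.
Local Notation dom F := (R F setT).
Let cR : coherent R := tR.

Lemma forests_ex N F E : dom F -> (0 < N)%N -> forests R N F E -> exists f, E f.
Proof.
case: F => [_ _ /= E0|s F dF N0]; first by exists [::].
rewrite forests_cons => FE.
have pF : ProperFilter (product (nseq N (trees R N (s :: F)))).
  apply: product_proper => g /nseqP[-> _]; split; first exact: (tower_good tR).
  exact: trees_filter.
exact: filter_ex FE.
Qed.

(** [C] is not excluded as a set of chains made of a new root and of a chain with
    levels [F]: generic trees admit a root all of whose branches lie in [C]. *)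
Definition rootable F (C : set (seq A)) : Prop := forall N E D, (0 < N)%N ->
  forests R N F E -> P (size F).+1 D ->
  exists z f, E f /\ {in branches (size F) f, forall pi, D (z :: pi) /\ C (z :: pi)}.

Lemma rootable_witness F N E C : dom F -> (0 < N)%N -> forests R N F E ->
  rootable F C -> forall D, P (size F).+1 D -> exists z f pi,
  [/\ E f, pi \in branches (size F) f, D (z :: pi) & C (z :: pi)].
Proof.
move=> dF N0 FE gC D PD.
have fF := forests_filter cR N dF.
have [z [f [[Ef ff] bf]]] := gC N _ D N0 (filterI FE (forests_full cR N dF)) PD.
case eb : (branches (size F) f) => [|pi pis].
  by have := full_branches ff; rewrite eb /= => /esym/eqP; rewrite expn_eq0 -leqn0 leqNgt N0.
have pib : pi \in branches (size F) f by rewrite eb mem_head.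
by have [Dz Cz] := bf _ pib; exists z, f, pi; split.
Qed.

Lemma rootableS F C D : C `<=` D -> rootable F C -> rootable F D.
Proof.
move=> CD gC N E D0 N0 FE PD; have [z [f [Ef bf]]] := gC N E D0 N0 FE PD.
by exists z, f; split=> // pi /bf[D0z /CD].
Qed.

(** Some root exists: finitely many branches of a generic forest have a common
    root, by [chain_root]. *)
Lemma rootable_size F : dom F -> rootable F [set l | size l = (size F).+1].
Proof.
move=> dF N E D N0 FE PD.
have [D' PD' D'P] := chain_root bP (N ^ size F) PD.
have fF := forests_filter cR N dF.
have FD' := forests_branches cR N dF (tower_chain tR dF PD').
have [f [[Ef ff] bf]] := forests_ex dF N0
  (filterI (filterI FE (forests_full cR N dF)) FD').
have [z zP] := D'P (branches (size F) f) (eq_leq (full_branches ff)) bf.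
exists z, f; split=> // pi pif; split; first exact: zP.
by rewrite /= (branches_size pif).
Qed.

(** Partition regularity.  This is why the new chains can be given a type. *)
Lemma rootable_or F C1 C2 : dom F ->
  rootable F (C1 `|` C2) -> rootable F C1 \/ rootable F C2.
Proof.
move=> dF gC; apply: contrapT => /not_orP[].
move=> /existsNP[N1 /existsNP[E1 /existsNP[D1]]].
move=> /not_implyP[N10 /not_implyP[FE1 /not_implyP[PD1 n1]]].
move=> /existsNP[N2 /existsNP[E2 /existsNP[D2]]].
move=> /not_implyP[N20 /not_implyP[FE2 /not_implyP[PD2 n2]]].
have FE := forests_dichotomy cR dF FE1 FE2.
have N0 : (0 < N1 + N2)%N by rewrite addn_gt0 N10.
have ? := chain_filter bP (size F).+1.
have [z [f [[L1 [L2 [L1P L2P Lk]]] bf]]] := gC _ _ _ N0 FE (filterI PD1 PD2).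
have [[g gL gk]|[g gL gk]] := Lk (fun pi => `[< C1 (z :: pi) >]).
  apply: n1; exists z, g; have [Eg sg] := L1P _ gL; split=> // pi pig.
  by have /asboolP := gk _ pig; have [[]] := bf _ (sg _ pig).
apply: n2; exists z, g; have [Eg sg] := L2P _ gL; split=> // pi pig.
by have /asboolPn := gk _ pig; have [[_ D2z] [|]] := bf _ (sg _ pig).
Qed.

Lemma rootable_mask F m C : dom F -> size m = size F ->
  rootable F [set l | C (mask (true :: m) l)] -> rootable (mask m F) C.
Proof.
move=> dF sm gC N E D N0 FE PD.
have PD' : P (size F).+1 [set l | D (mask (true :: m) l)].
  have := @chain_mask _ _ bP (true :: m) D; rewrite /= add1n sm; apply.
  by rewrite -(size_mask sm).
have [z [f [[g Eg gf] bf]]] := gC _ _ _ N0 (forests_mask cR N0 dF sm FE) PD'.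
by exists z, g; split=> // pi /gf[pi' /bf[/= Dz Cz] ->].
Qed.

Lemma rootable_tail F D : dom F -> R F D -> ~ rootable F [set l | ~ D (behead l)].
Proof.
move=> dF RD /(rootable_witness dF (ltnSn 0) (forests_branches cR 1 dF RD)).
have ? := chain_filter bP (size F).+1.
by move=> /(_ setT filterT)[z [f [pi [/= fD /fD Dpi _]]]].
Qed.

Lemma rootable_chain F D : dom F -> P (size F).+1 D -> ~ rootable F (~` D).
Proof.
move=> dF PD /(rootable_witness dF (ltnSn 0) (forests_full cR 1 dF)).
by move=> /(_ _ PD)[z [f [pi [_ _]]]].
Qed.

(** A point is a new root with an assignment of nodes to all the levels below; an
    ultrafilter containing this filter consists of rootable sets, for all
    finite sets of levels simultaneously. *)
Definition root_filter : set_system (A * (level A -> A)) :=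
  [set H | exists F C, [/\ dom F, ~ rootable F (~` C) &
    forall z e, C (z :: map e F) -> H (z, e)]].

Lemma root_filter_proper : dom [::] -> ProperFilter root_filter.
Proof.
move=> d0; split.
  move=> [F [C [dF nC CH]]]; apply: nC.
  apply: rootableS (rootable_size dF) => -[//|z pi] /= [spi] Czpi.
  apply: (CH z (fun s => nth z pi (index s F))).
  suff -> : [seq nth z pi (index s F) | s <- F] = pi by [].
  apply: (@eq_from_nth _ z); rewrite size_map // => i iF.
  rewrite (nth_map (set0, 0%N)) // index_uniq //; exact: (tower_uniq tR).
split.
- exists [::], setT; split=> //; apply: rootable_chain => //.
  by have ? := chain_filter bP (size ([::] : seq (level A))).+1; exact: filterT.
- move=> H1 H2 [F1 [C1 [dF1 n1 CH1]]] [F2 [C2 [dF2 n2 CH2]]].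
  have [F [dF /subseqP[m1 sm1 F1E] /subseqP[m2 sm2 F2E]]] := tower_dir tR dF1 dF2.
  exists F, ([set l | C1 (mask (true :: m1) l)] `&` [set l | C2 (mask (true :: m2) l)]).
  split=> //.
    rewrite setCI => /(rootable_or dF)[g|g].
      by apply: n1; rewrite F1E; exact: rootable_mask sm1 g.
    by apply: n2; rewrite F2E; exact: rootable_mask sm2 g.
  move=> z e [/= Cz1 Cz2]; split; [apply: CH1|apply: CH2].
    by rewrite F1E map_mask.
  by rewrite F2E map_mask.
- by move=> H1 H2 H12 [F [C [dF nC CH]]]; exists F, C; split=> // z e /CH/H12.
Qed.

Section Top.
Variable V : set_system (A * (level A -> A)).
Hypothesis VU : UltraFilter V.
Hypothesis rV : root_filter `<=` V.
Hypothesis d0 : dom [::].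

Lemma top_dom F C : dom F -> R F C <-> V [set ze | C (map ze.2 F)].
Proof.
move=> dF.
have RV D : R F D -> V [set ze | D (map ze.2 F)].
  move=> RD; apply: rV; exists F, [set l | D (behead l)]; split=> //.
  exact: rootable_tail.
split; first exact: RV.
have [//|/RV VnC VC] := in_ultra_setVsetC C (coh_ultra cR dF).
by have [ze []] := filterI_ex _ VC VnC.
Qed.

Lemma top_chain F C : dom F -> P (size F).+1 C -> V [set ze | C (ze.1 :: map ze.2 F)].
Proof. by move=> dF PC; apply: rV; exists F, C; split=> //; exact: rootable_chain. Qed.

Lemma top_good F C : dom F -> V [set ze | C (ze.1 :: map ze.2 F)] -> rootable F C.
Proof.
move=> dF VC; apply: contrapT => nC.
have VnC : V [set ze | ~ C (ze.1 :: map ze.2 F)].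
  by apply: rV; exists F, (~` C); split=> //; rewrite setCK.
by have [ze []] := filterI_ex _ VC VnC.
Qed.

Definition top_type : set (set A) := [set B | V [set ze | B ze.1]].

Variable j : nat.
Hypothesis jnew : ~ dom [:: (top_type, j)].
Let top : level A := (top_type, j).

Definition extension (G : seq (level A)) : set_system (seq A) :=
  [set C | R G C \/ exists F, [/\ G = top :: F, dom F & V [set ze | C (ze.1 :: map ze.2 F)]]].

Lemma top_notin F : dom F -> top \notin F.
Proof.
move=> dF; apply/negP => tF; apply: jnew; apply: (dom_subseq cR) dF.
by rewrite sub1seq.
Qed.

Lemma extension_old G : dom G -> extension G = R G.
Proof.
move=> dG; apply/seteqP; split=> C; last by left.
by case=> // -[F [GE _ _]]; have := top_notin dG; rewrite GE mem_head.
Qed.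

Lemma extension_new F : dom F ->
  extension (top :: F) = [set C | V [set ze | C (ze.1 :: map ze.2 F)]].
Proof.
move=> dF; apply/seteqP; split=> C; last by right; exists F.
case=> [/(tower_dom tR)/top_notin|[F' [[<-]]]//].
by rewrite mem_head.
Qed.

Lemma extension_domP G : extension G setT ->
  dom G \/ exists2 F, G = top :: F & dom F.
Proof. by case=> [|[F [-> dF _]]]; [left|right; exists F]. Qed.

Lemma extension_tower : tower P extension.
Proof.
split.
- split.
  + move=> G /extension_domP[dG|[F -> dF]].
      by rewrite extension_old //; exact: coh_ultra.
    rewrite extension_new //; apply: ultra_decide => C.
    exact: (in_ultra_setVsetC [set ze | C (ze.1 :: map ze.2 F)] VU).
  + move=> G m /extension_domP[dG|[F -> dF]] C.
      by rewrite !extension_old //; [exact: (coh_mask cR)|exact: (dom_mask cR)].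
    rewrite extension_new //; case: m => [|[] m] /=.
    * by rewrite extension_old // top_dom.
    * rewrite extension_new; last exact: dom_mask.
      by rewrite /= ; under eq_set do rewrite map_mask.
    * rewrite extension_old; last exact: dom_mask.
      rewrite top_dom; last exact: dom_mask.
      by under eq_set do rewrite map_mask.
  + move=> G /extension_domP[dG|[F -> dF]].
      by rewrite extension_old //; exact: coh_size.
    by rewrite extension_new //; apply: (@filterE _ V) => ze /=; rewrite size_map.
- move=> G C [/(tower_dom tR)|[F [-> dF _]]]; first by left.
  by rewrite extension_new //; exact: filterT.
- have new_dom F : dom F -> extension (top :: F) setT.
    by move=> dF; rewrite extension_new //; exact: filterT.
  have sub_top F G : subseq F G -> subseq F (top :: G).
    by move=> FG; apply: subseq_trans FG _; exact: subseq_cons.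
  move=> G1 G2 /extension_domP[dG1|[F1 -> dF1]] /extension_domP[dG2|[F2 -> dF2]].
  + have [H [dH s1 s2]] := tower_dir tR dG1 dG2.
    by exists H; split=> //; rewrite extension_old.
  + have [H [dH s1 s2]] := tower_dir tR dG1 dF2.
    by exists (top :: H); split; [exact: new_dom|exact: sub_top|rewrite /= eqxx].
  + have [H [dH s1 s2]] := tower_dir tR dF1 dG2.
    by exists (top :: H); split; [exact: new_dom|rewrite /= eqxx|exact: sub_top].
  + have [H [dH s1 s2]] := tower_dir tR dF1 dF2.
    by exists (top :: H); split; [exact: new_dom|rewrite /= eqxx|rewrite /= eqxx].
- move=> G /extension_domP[|[F -> dF]]; first exact: (tower_uniq tR).
  by rewrite cons_uniq top_notin // (tower_uniq tR).
- move=> s C /extension_domP[ds|[F [sE FE] dF]].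
    by rewrite extension_old //; exact: (tower_level tR).
  by rewrite sE extension_new.
- move=> G /extension_domP[dG|[F -> dF]].
    by rewrite extension_old //; exact: (tower_chain tR).
  by rewrite extension_new // => C; exact: top_chain.
- have old N F : dom F -> forests extension N F = forests R N F.
    by move=> dF; apply: forests_ext => G /(dom_suffix cR)/(_ dF)/extension_old.
  move=> G N /extension_domP[dG|[F -> dF]] N0 G0.
    rewrite (@trees_ext _ _ extension R) => [|H /(dom_suffix cR)/(_ dG)/extension_old //].
    exact: (tower_good tR).
  move=> /treesE[E [C [FE VC CE]]]; move: FE VC; rewrite old // extension_new // => FE VC.
  have ? := chain_filter bP (size F).+1.
  have [z [f [Ef bf]]] := top_good dF VC N0 FE filterT.
  by apply: (CE z f Ef) => pi /bf[].
Qed.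

End Top.
End Extension.

(** * A tower with infinitely many levels of the same type *)

Section Maximal.
Variables (A : eqType) (P : nat -> set_system (seq A)).
Hypothesis bP : chain_filters P.

Implicit Types X Y : set (seq (level A) * set (seq A)).

(** Towers are encoded as sets of pairs so that Zorn's lemma for inclusion applies. *)
Definition family_of X : seq (level A) -> set_system (seq A) := fun F C => X (F, C).

Lemma family_of_sub X Y F : X `<=` Y -> tower P (family_of X) -> tower P (family_of Y) ->
  family_of X F setT -> family_of Y F = family_of X F.
Proof.
move=> XY tX tY dF; apply/seteqP; split=> C; last exact: XY.
have UX := coh_ultra tX dF.
have dY : family_of Y F setT by exact: XY.
have UY := coh_ultra tY dY.
move=> YC; have [//|XnC] := in_ultra_setVsetC C UX.
by have [pi []] := filterI_ex (F := family_of Y F) _ YC (XY _ XnC).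
Qed.

(** The types of chains are ultrafilters, so that they do not change along an
    increasing family of towers; see [family_of_sub]. *)
Lemma tower_bigcup (S : set (set (seq (level A) * set (seq A)))) :
  S `<=` [set X | tower P (family_of X)] -> total_on S subset ->
  tower P (family_of (\bigcup_(X in S) X)).
Proof.
move=> St Stot; set U := \bigcup_(X in S) X.
have tS X : S X -> tower P (family_of X) by move=> /St.
have domU F : family_of U F setT -> exists2 X, S X & family_of X F setT by case=> X SX; exists X.
have famU X F : S X -> family_of X F setT -> family_of U F = family_of X F.
  move=> SX dF; apply/seteqP; split=> C; last by exists X.
  case=> Y SY YC; have [XY|YX] := Stot _ _ SX SY; last exact: YX.
  by rewrite -(family_of_sub XY (tS _ SX) (tS _ SY) dF).
have dom2 F G : family_of U F setT -> family_of U G setT ->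
    exists X, [/\ S X, family_of X F setT & family_of X G setT].
  move=> /domU[X SX XF] /domU[Y SY YG].
  have [XY|YX] := Stot _ _ SX SY.
    by exists Y; split=> //; exact: XY.
  by exists X; split=> //; exact: YX.
split.
- split.
  + move=> F /domU[X SX dF]; rewrite (famU X) //.
    exact: (coh_ultra (tS _ SX) dF).
  + move=> F m /domU[X SX dF] C.
    have dm : family_of X (mask m F) setT by exact: (dom_mask (tS _ SX) m dF).
    rewrite !(famU X) //.
    exact: (coh_mask (tS _ SX) m dF C).
  + move=> F /domU[X SX dF]; rewrite (famU X) //.
    exact: (coh_size (tS _ SX) dF).
- by move=> F C [X SX XC]; exists X => //; exact: (tower_dom (tS _ SX) XC).
- move=> F G dF dG; have [X [SX XF XG]] := dom2 _ _ dF dG.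
  have [H [dH FH GH]] := tower_dir (tS _ SX) XF XG.
  by exists H; split=> //; exists X.
- by move=> F /domU[X SX dF]; exact: (tower_uniq (tS _ SX) dF).
- move=> s C /domU[X SX dF]; rewrite (famU X) //; exact: (tower_level (tS _ SX) _ dF).
- move=> F /domU[X SX dF]; rewrite (famU X) //; exact: (tower_chain (tS _ SX) dF).
- move=> F N /domU[X SX dF] N0 F0; rewrite (@trees_ext _ _ _ (family_of X)).
    exact: (tower_good (tS _ SX) dF N0 F0).
  by move=> G /(dom_suffix (tS _ SX))/(_ dF); exact: famU.
Qed.

Definition base_state : set (seq (level A) * set (seq A)) :=
  [set x | x.1 = [::] /\ x.2 [::]].

Lemma base_tower : tower P (family_of base_state).
Proof.
have domB F : family_of base_state F setT -> F = [::] by case.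
split.
- split.
  + move=> F /domB ->.
    have pB : ProperFilter (family_of base_state [::]).
      split; first by case.
      by split; [|move=> C D [_ ?] [_ ?]|move=> C D CD [_ /CD]].
    apply: ultra_decide => C; have [C0|C0] := EM (C [::]); [left|right]; by split.
  + move=> F [|b m] /domB -> C; split; by case=> _ C0; split.
  + by move=> F /domB ->; split.
- by move=> F C [/= -> _].
- by move=> F G /domB -> /domB ->; exists [::].
- by move=> F /domB ->.
- by move=> s C /domB.
- by move=> F /domB -> C /(chain_nil bP) C0; split.
- by move=> F N /domB ->.
Qed.

(** On top of a maximal tower one can still put a level, with an ultrafilter that is
    determined before its label is chosen: no label can be new. *)
Lemma constant_tower : exists R : seq (level A) -> set_system (seq A),
  tower P R /\ exists q, forall j : nat, R [:: (q, j)] setT.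
Proof.
have [X [tX Xmax]] := Zorn_bigcup tower_bigcup.
have d0 : family_of X [::] setT.
  have [/eqP X0|] := boolP (X == set0).
    exfalso; apply: (Xmax base_state); last exact: base_tower.
    split; first by rewrite X0; exact: sub0set.
    by rewrite X0 => /(_ ([::], setT)); apply; split.
  move=> /set0P[[F C] XC]; have dF : family_of X F setT by exact: (tower_dom tX XC).
  by apply: (dom_subseq tX) dF; exact: sub0seq.
exists (family_of X); split=> //.
have [V [VU rV]] := ultraFilterLemma (root_filter_proper bP tX d0).
exists (top_type V) => j; apply: contrapT => jnew.
have tY := extension_tower bP tX VU rV d0 jnew.
apply: (Xmax [set x | extension (family_of X) V j x.1 x.2]); last exact: tY.
split; first by move=> [F C] XC; left.
move=> /(_ ([:: (top_type V, j)], setT)) H; apply: jnew; apply: H => /=.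
by right; exists [::]; split=> //; exact: filterT.
Qed.

End Maximal.

(** * Words, and chains of binary trees *)

Lemma mask_true_cat (T : Type) a m (s : seq T) :
  mask (nseq a true ++ m) s = take a s ++ mask m (drop a s).
Proof. by elim: a s => [|a IH] [|x s] //=; rewrite ?take0 ?drop0 ?mask0 ?IH //; case: m. Qed.

Lemma mask_false_cat (T : Type) a m (s : seq T) :
  mask (nseq a false ++ m) s = mask m (drop a s).
Proof. by elim: a s => [|a IH] [|x s] //=; rewrite ?drop0 ?mask0 ?IH //; case: m. Qed.

Lemma take_drop_flatten (T : Type) l i (ws : seq (seq T)) :
  all (fun w => size w == l) ws -> (i < size ws)%N ->
  take l (drop (l * i) (flatten ws)) = nth [::] ws i.
Proof.
elim: ws i => [//|w ws IH] [|i] /= /andP[/eqP sw wsl].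
  by rewrite muln0 drop0 take_size_cat.
by rewrite ltnS => iws; rewrite mulnS -sw drop_cat ltnNge leq_addr /= addKn sw IH.
Qed.

Lemma size_flatten_blocks (T : Type) l (ws : seq (seq T)) :
  all (fun w => size w == l) ws -> size (flatten ws) = (l * size ws)%N.
Proof.
elim: ws => [|w ws IH] /=; first by rewrite muln0.
by move=> /andP[/eqP sw /IH sws]; rewrite size_cat sw sws mulnS.
Qed.

Lemma flatten_groups (T : Type) h c (s : seq T) :
  flatten [seq take h (drop (g * h) s) | g <- iota 0 c] = take (c * h) s.
Proof.
elim: c => [|c IH]; first by rewrite mul0n take0.
by rewrite -addn1 iotaD map_cat flatten_cat IH /= cats0 add0n addn1 mulSn addnC takeD.
Qed.

Lemma subseq_flatten_map (I : Type) (T : eqType) (f g : I -> seq T) (r : seq I) :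
  (forall i, subseq (f i) (g i)) ->
  subseq (flatten [seq f i | i <- r]) (flatten [seq g i | i <- r]).
Proof. by move=> fg; elim: r => //= i r IH; exact: cat_subseq. Qed.

Lemma subseq_flatten (T : eqType) (s t : seq (seq T)) :
  subseq s t -> subseq (flatten s) (flatten t).
Proof.
elim: t s => [|y t IH] [|x s] //=; first by rewrite sub0seq.
case: eqP => [-> /IH|_ /IH] st; first exact: cat_subseq (subseq_refl _) st.
by apply: subseq_trans st _; exact: suffix_subseq.
Qed.

Lemma subseq_pair (T : eqType) (x0 : T) (s : seq T) i j : (i < j < size s)%N ->
  subseq [:: nth x0 s i; nth x0 s j] s.
Proof.
elim: s i j => [|x s IH] i [|j] /=; rewrite ?ltn0 ?andbF // !ltnS.
case: i => [|i] /=.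
  by move=> js; rewrite eqxx sub1seq mem_nth.
move=> ijs; case: eqP => _; last exact: IH.
by apply: subseq_trans (IH _ _ ijs); exact: subseq_cons.
Qed.

(** Repeating a list often enough contains all short lists with the same entries;
    this allows one sequence of blocks to stand for all of them. *)
Lemma subseq_repeat (T : eqType) (s t : seq T) n :
  {subset s <= t} -> (size s <= n)%N -> subseq s (flatten (nseq n t)).
Proof.
elim: s n => [|x s IH] [|n] //= st; rewrite ?sub0seq // ltnS => sn.
rewrite -cat1s; apply: cat_subseq.
  by rewrite sub1seq st ?mem_head.
by apply: IH => // y ys; apply: st; rewrite in_cons ys orbT.
Qed.

Fixpoint words n : seq (seq bool) :=
  if n is n'.+1 then
    [::] :: [seq false :: w | w <- words n'] ++ [seq true :: w | w <- words n']
  else [::].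

Lemma mem_words n w : (w \in words n) = (size w < n)%N.
Proof.
elim: n w => [|n IH] [|b w] //=; rewrite in_cons mem_cat /= ltnS -IH.
have inj (c : bool) : injective (cons c) by move=> u v [].
have other (c d : bool) : c != d -> (c :: w \in [seq d :: v | v <- words n]) = false.
  by move=> cd; apply/negbTE/negP => /mapP[v _ [cE]]; rewrite cE eqxx in cd.
by case: b; [rewrite (other true false)|rewrite (other false true)];
  rewrite // ?orbF mem_map //; exact: inj.
Qed.

(** Below a word of [Y] the search stops, so that the list is complete for antichains.
    The lexicographic order is the one in which subtrees are generic over each
    other. *)
Fixpoint antichain_words n (Y : pred (seq bool)) : seq (seq bool) :=
  if n is n'.+1 then
    if Y [::] then [:: [::]] else
    [seq false :: w | w <- antichain_words n' (fun w => Y (false :: w))] ++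
    [seq true :: w | w <- antichain_words n' (fun w => Y (true :: w))]
  else [::].

(** A finite list containing all values of [antichain_words n], so that a tree can be
    generic for all antichains at once. *)
Fixpoint all_antichain_words n : seq (seq (seq bool)) :=
  if n is n'.+1 then
    [:: [::]] :: [seq [seq false :: w | w <- u] ++ [seq true :: w | w <- v] |
      u <- all_antichain_words n', v <- all_antichain_words n']
  else [:: [::]].

Lemma antichain_words_all n Y : antichain_words n Y \in all_antichain_words n.
Proof.
elim: n Y => [//|n IH] Y /=; case: ifP => _; first exact: mem_head.
rewrite in_cons; apply/orP; right; apply/allpairsP.
exists (antichain_words n (fun w => Y (false :: w)), antichain_words n (fun w => Y (true :: w))).
by split=> //; exact: IH.
Qed.

Lemma size_antichain_words n Y : (size (antichain_words n Y) <= 2 ^ n)%N.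
Proof.
elim: n Y => [//|n IH] Y /=; case: ifP => _; first by rewrite expn_gt0.
by rewrite size_cat !size_map expnS mul2n -addnn leq_add.
Qed.

Lemma antichain_words_short n Y w : w \in antichain_words n Y -> (size w < n)%N.
Proof.
elim: n Y w => [//|n IH] Y w /=; case: ifP => _; first by rewrite inE => /eqP ->.
by rewrite mem_cat => /orP[] /mapP[v /IH vn ->].
Qed.

Lemma mem_antichain_words n (Y : pred (seq bool)) w :
  (forall u v, Y u -> Y v -> prefix u v -> u = v) ->
  Y w -> (size w < n)%N -> w \in antichain_words n Y.
Proof.
elim: n Y w => [//|n IH] Y [|b w] anti Yw /=; first by rewrite Yw mem_head.
rewrite ltnS => wn; case: ifP => [Y0|_].
  by have := anti _ _ Y0 Yw (prefix0s _).
have H : w \in antichain_words n (fun w => Y (b :: w)).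
  apply: IH => // u v Yu Yv uv.
  by have /= := anti _ _ Yu Yv; rewrite eqxx => /(_ uv)[].
rewrite mem_cat; apply/orP; case: b {Yw} H => H; [right|left]; exact: map_f.
Qed.

Section Blocks.
Variable A : eqType.
Implicit Types t : tree A.

Fixpoint spine k t : seq A :=
  if k is k'.+1 then label t :: spine k' (head t (children t)) else [::].

(** The forest under the last node of the chain [spine k t]. *)
Fixpoint below k t : seq (tree A) :=
  match k with
  | 0 => [:: t]
  | 1 => children t
  | k'.+1 => below k' (head t (children t))
  end.

(** A tree with levels in blocks of size [l] is read as a binary tree of chains:
    inside a block follow first children, and between blocks follow the word [w]. *)
Fixpoint block l (w : seq bool) t : seq A :=
  if w is b :: w' then block l w' (nth t (below l t) b) else spine l t.

Lemma size_spine k t : size (spine k t) = k.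
Proof. by elim: k t => //= k IH t; rewrite IH. Qed.

Lemma size_block l w t : size (block l w t) = l.
Proof. by elim: w t => [|b w IH] t /=; rewrite ?size_spine. Qed.

Lemma take_spine l k t : (l <= k)%N -> take l (spine k t) = spine l t.
Proof. by elim: l k t => [|l IH] [|k] t //= lk; rewrite IH. Qed.

Lemma head_child n t : full 2 n.+1 (children t) -> head t (children t) \in children t.
Proof. by case: (children t) => //= u f _; exact: mem_head. Qed.

Lemma full_child N n (f : seq (tree A)) t : full N n.+1 f -> t \in f -> full N n (children t).
Proof. by move=> /= /andP[_ /allP]; apply. Qed.

Lemma spine_branch n t : full 2 n (children t) -> spine n.+1 t \in branches n.+1 [:: t].
Proof.
elim: n t => [|n IH] t ft; first by rewrite /= mem_head.
have hc := head_child ft.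
have sb : {subset branches n.+1 [:: head t (children t)] <= branches n.+1 (children t)}.
  by apply: branches_sub => u; rewrite inE => /eqP ->.
have {}IH := sb _ (IH _ (full_child ft hc)).
apply/allpairsPdep; exists t, (spine n.+1 (head t (children t))).
by split=> //; exact: mem_head.
Qed.

Lemma below_full l n t : full 2 (l + n) (children t) -> full 2 n (below l.+1 t).
Proof.
elim: l t => [//|l IH] t ft; apply: IH.
exact: (full_child ft (head_child ft)).
Qed.

Lemma spine_below_branch l m n t u pi : full 2 (l + m) (children t) ->
  u \in below l.+1 t -> pi \in branches n.+1 [:: u] ->
  spine l.+1 t ++ pi \in branches (l.+1 + n.+1) [:: t].
Proof.
elim: l t => [|l IH] t ft ub pib.
  apply/allpairsPdep; exists t, pi; split=> //; first exact: mem_head.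
  apply: branches_sub pib => v; rewrite inE => /eqP ->; exact: ub.
have hc := head_child ft.
have := IH _ (full_child ft hc) ub pib => IHt.
apply/allpairsPdep; exists t, (spine l.+1 (head t (children t)) ++ pi); split=> //.
  exact: mem_head.
by apply: branches_sub IHt => v; rewrite inE => /eqP ->.
Qed.

Lemma block_branch l k w t : (size w <= k)%N ->
  full 2 (l + l.+1 * k) (children t) ->
  exists2 pi, pi \in branches (l.+1 * k.+1) [:: t] &
   take l.+1 pi = spine l.+1 t /\ take l.+1 (drop (l.+1 * size w) pi) = block l.+1 w t.
Proof.
elim: w k t => [|b w IH] k t.
  move=> _ ft; exists (spine (l.+1 * k.+1) t).
    have -> : (l.+1 * k.+1 = (l + l.+1 * k).+1)%N by rewrite mulnS addSn.
    exact: spine_branch.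
  by rewrite muln0 drop0 take_spine // leq_pmulr.
case: k => [//|k] wk ft.
have fb := below_full ft.
set u := nth t (below l.+1 t) b.
have ub : u \in below l.+1 t.
  apply: mem_nth; move: fb; rewrite mulnS addSn => /andP[/eqP -> _]; exact: leq_b1.
have fu : full 2 (l + l.+1 * k) (children u).
  by apply: full_child ub; rewrite -addSn -mulnS.
have [pi pib [_ wpi]] := IH k u wk fu.
exists (spine l.+1 t ++ pi).
  have E : (l.+1 * k.+1 = (l + l.+1 * k).+1)%N by rewrite mulnS addSn.
  by rewrite mulnS E; apply: spine_below_branch ft ub _; rewrite -E.
rewrite take_size_cat ?size_spine //; split=> //.
by rewrite mulnS drop_cat size_spine ltnNge leq_addr /= addKn.
Qed.

End Blocks.

(** * The types of chains and of antichains of chains *)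

Section Follows.
Variables (A Lev : eqType) (R : seq Lev -> set_system (seq A)).

(** The chains selected by [Phi] in a [T]-generic object form a Morley sequence in the
    types of the chains with levels [Gs]. *)
Definition follows (Z : Type) (T : set_system Z) (Phi : Z -> seq (seq A))
    (Gs : seq (seq Lev)) : Prop :=
  forall D, product [seq R G | G <- Gs] D -> T [set z | D (Phi z)].

Lemma follows2 (Z : Type) (T : set_system Z) Phi0 Phi1 Gs0 Gs1 D :
  Filter T -> follows T Phi0 Gs0 -> follows T Phi1 Gs1 ->
  product [seq R G | G <- Gs0 ++ Gs1] D ->
  product [:: T; T] [set f | forall d, D (Phi0 (nth d f 0) ++ Phi1 (nth d f 1))].
Proof.
move=> TF f0 f1; rewrite map_cat product_cat => /f0 /=.
by apply: filterS => z /f1; apply: filterS.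
Qed.

Lemma follows_product (I : eqType) (Z : Type) (T : I -> set_system Z) (Phi : Z -> seq (seq A))
    (Gs : I -> seq (seq Lev)) (r : seq I) :
  {in r, forall i, Filter (T i) /\ follows (T i) Phi (Gs i)} ->
  follows (product [seq T i | i <- r]) (fun l => flatten [seq Phi z | z <- l])
    (flatten [seq Gs i | i <- r]).
Proof.
elim: r => [|i r IH] rP D //=; rewrite map_cat product_cat.
have [TF fi] := rP _ (mem_head _ _).
have rP' : {in r, forall i, Filter (T i) /\ follows (T i) Phi (Gs i)}.
  by move=> j jr; apply: rP; rewrite in_cons jr orbT.
by move=> /fi; apply: filterS => z /(IH rP').
Qed.

Hypothesis cR : coherent R.
Local Notation dom F := (R F setT).

(** What lies under a chain of nodes is generic for the levels below. *)
Lemma trees_below l (w F : seq Lev) E : size w = l.+1 -> dom (w ++ F) ->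
  forests R 2 F E -> trees R 2 (w ++ F) [set t | E (below l.+1 t)].
Proof.
elim: l w => [|l IH] [|s w] //= [sw] dF FE.
  by case: w sw dF => // _ dF; exists E, setT.
have dF' := dom_cons cR dF.
exists [set f | forall z, E (below l.+1 (head (Node z f) f))], setT.
split=> //; last by move=> z f Ef _; exact: Ef.
case: w sw dF dF' => // s' w [sw] dF dF'.
have TF := trees_filter cR 2 dF'.
rewrite [_ ++ _]/= forests_cons.
have := IH (s' :: w); rewrite [size _]/= sw => /(_ erefl dF' FE) H.
rewrite /=; apply: (@filterS _ _ TF) H => t Et.
exact: (@filterE _ _ TF).
Qed.

Variable l : nat.
Local Notation sized_blocks ws := (all (fun w => size w == l.+1) ws).

Lemma trees_block_branch (ws : seq (seq Lev)) w : sized_blocks ws -> dom (flatten ws) ->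
  (size w < size ws)%N -> trees R 2 (flatten ws) [set t |
    exists2 pi, pi \in branches (size (flatten ws)) [:: t] &
    take l.+1 pi = spine l.+1 t /\
    take l.+1 (drop (l.+1 * size w) pi) = block l.+1 w t].
Proof.
move=> wsl dF wws; have sF := size_flatten_blocks wsl.
case: ws wws wsl dF sF => [//|w0 ws]; rewrite [size (_ :: _)]/= ltnS => wws wsl dF sF.
case FE : (flatten _) dF sF => [|s F] dF sF; first by rewrite mulnS in sF.
have tF : trees R 2 (s :: F) [set t | full 2 (size F) (children t)].
  exists [set f | full 2 (size F) f], setT; split=> //.
  exact: forests_full (dom_cons cR dF).
have TF := trees_filter cR 2 dF.
rewrite sF; apply: filterS tF => t ft; apply: block_branch => //.
by move: sF; rewrite [size (_ :: _)]/= mulnS addSn => -[<-].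
Qed.

Lemma trees_spine (ws : seq (seq Lev)) C : sized_blocks ws -> dom (flatten ws) ->
  (0 < size ws)%N -> R (nth [::] ws 0) C ->
  trees R 2 (flatten ws) [set t | C (spine l.+1 t)].
Proof.
move=> wsl dF ws0 RC.
have TF := trees_filter cR 2 dF.
have := trees_block_branch (w := [::]) wsl dF ws0.
have : R (flatten ws) [set pi | C (mask (nseq l.+1 true) pi)].
  apply/(coh_mask cR) => //.
  have := mask_true_cat l.+1 [::] (flatten ws); rewrite cats0 => ->.
  rewrite mask0s cats0; move: RC; rewrite -(take_drop_flatten wsl ws0).
  by rewrite muln0 drop0.
case FE : (flatten ws) dF TF => [|s F] dF TF RC'.
  have := size_flatten_blocks wsl; rewrite FE.
  by case: (ws) ws0 => // a b _; rewrite mulnS.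
have := trees_branches cR 2 dF RC' => H1 H2.
apply: filterS (filterI H1 H2) => t [Ct [pi /Ct /= Cpi [tpi _]]].
move: Cpi; have := mask_true_cat l.+1 [::] pi; rewrite cats0 mask0s cats0 => ->.
by rewrite tpi.
Qed.

Lemma trees_pair (ws : seq (seq Lev)) w C : sized_blocks ws -> dom (flatten ws) ->
  w <> [::] -> (size w < size ws)%N -> R (nth [::] ws 0 ++ nth [::] ws (size w)) C ->
  trees R 2 (flatten ws) [set t | C (spine l.+1 t ++ block l.+1 w t)].
Proof.
move=> wsl dF w0 wws RC.
have TF := trees_filter cR 2 dF.
have ws0 : (0 < size ws)%N by apply: leq_trans wws.
have := trees_block_branch wsl dF wws.
pose m := nseq l.+1 true ++ nseq (l.+1 * size w - l.+1) false ++ nseq l.+1 true ++ [::].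
have mE (X : Type) (s : seq X) :
    mask m s = take l.+1 s ++ take l.+1 (drop (l.+1 * size w) s).
  rewrite /m mask_true_cat mask_false_cat mask_true_cat mask0s cats0 drop_drop subnK //.
  by case: (w) w0 => // a b _; rewrite leq_pmulr.
have : R (flatten ws) [set pi | C (mask m pi)].
  apply/(coh_mask cR) => //; rewrite mE take_drop_flatten //.
  by have := take_drop_flatten wsl ws0; rewrite muln0 drop0 => ->.
case FE : (flatten ws) dF TF => [|s F] dF TF RC'.
  have := size_flatten_blocks wsl; rewrite FE.
  by case: (ws) ws0 => // a b _; rewrite mulnS.
have := trees_branches cR 2 dF RC' => H1 H2.
apply: filterS (filterI H1 H2) => t [Ct [pi /Ct /= Cpi [tpi bpi]]].
by move: Cpi; rewrite mE tpi bpi.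
Qed.

Lemma forests_blocks (ws : seq (seq Lev)) : sized_blocks ws -> ws <> [::] ->
  forests R 2 (flatten ws) = product [:: trees R 2 (flatten ws); trees R 2 (flatten ws)].
Proof.
move=> wsl ws0; case FE : (flatten ws) => [|s F] //.
have := size_flatten_blocks wsl; rewrite FE.
by case: (ws) ws0 => // a b _; rewrite mulnS.
Qed.

Lemma follows_pair (ws : seq (seq Lev)) u w : sized_blocks ws -> dom (flatten ws) ->
  w <> [::] -> (size (u ++ w) < size ws)%N ->
  follows (trees R 2 (flatten ws))
    (fun t => [:: block l.+1 u t ++ block l.+1 (u ++ w) t])
    [:: nth [::] ws (size u) ++ nth [::] ws (size (u ++ w))].
Proof.
elim: u ws => [|b u IH] ws wsl dF w0 wws D.
  exact: trees_pair.
case: ws wsl dF wws => [//|w1 ws] wsl dF; rewrite [size (_ ++ _)]/= [size (_ :: _)]/= ltnS.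
move=> wws; have ws0 : ws <> [::] by case: (ws) wws.
have /andP[/eqP sw1 wsl'] := wsl.
have dF' : dom (flatten ws) by apply: (dom_suffix cR _ dF); exact: suffix_suffix.
have TF := trees_filter cR 2 dF.
have TF' := trees_filter cR 2 dF'.
have IHD := IH ws wsl' dF' w0 wws D => /= /IHD TD.
have := @trees_below l w1 (flatten ws)
  [set f | forall d, D [:: block l.+1 u (nth d f b) ++ block l.+1 (u ++ w) (nth d f b)]] sw1 dF.
have: forests R 2 (flatten ws)
  [set f | forall d, D [:: block l.+1 u (nth d f b) ++ block l.+1 (u ++ w) (nth d f b)]].
  rewrite forests_blocks //; case: (b) => /=.
    by apply: filterE => x; apply: filterS TD.
  by apply: filterS TD => t Dt; apply: filterE.
by move=> /[swap]/[apply]; apply: filterS => t; exact.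
Qed.

(** Nodes in distinct subtrees are generic over each other, which reduces an antichain
    to the antichains of the two subtrees.  The types that occur depend only on
    the levels of the nodes. *)
Lemma follows_antichain (ws : seq (seq Lev)) Y : sized_blocks ws -> dom (flatten ws) ->
  (0 < size ws)%N ->
  follows (trees R 2 (flatten ws))
    (fun t => [seq block l.+1 w t | w <- antichain_words (size ws) Y])
    [seq nth [::] ws (size w) | w <- antichain_words (size ws) Y].
Proof.
elim: ws Y => [//|w1 ws IH] Y wsl dF _ D.
have TF := trees_filter cR 2 dF.
rewrite [antichain_words _ _]/=; case: ifP => _.
  exact: trees_spine.
have /andP[/eqP sw1 wsl'] := wsl.
have dF' : dom (flatten ws) by apply: (dom_suffix cR _ dF); exact: suffix_suffix.
have [ws0|/eqP ws0] := eqVneq ws [::].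
  by move=> D0; apply: (@filterE _ _ TF) => t; move: D0; rewrite ws0.
have ws1 : (0 < size ws)%N by case: (ws) ws0.
have TF' := trees_filter cR 2 dF'.
have IH0 := IH (fun w => Y (false :: w)) wsl' dF' ws1.
have IH1 := IH (fun w => Y (true :: w)) wsl' dF' ws1.
have := follows2 (D := D) TF' IH0 IH1.
rewrite -forests_blocks // !map_cat -!map_comp /= => H /H /(trees_below sw1 dF).
apply: filterS => t /= Dt. by rewrite map_cat -!map_comp; exact: (Dt t).
Qed.

End Follows.

(** * Thickening chains until comparable nodes become incompatible *)

Section Patterns.
Variables (A : eqType) (Compat : set (seq A)).
Hypothesis Compat_sub : forall l l' : seq A, {subset l <= l'} -> Compat l' -> Compat l.

(** A finite approximation of the antichain tree property by tuples of length [s],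
    for the conjunction over the entries of a tuple. *)
Definition antichain_pattern (s n : nat) : Prop :=
  exists b : seq bool -> seq A, [/\ forall w, size (b w) = s,
    forall Y, Compat (flatten [seq b w | w <- antichain_words n Y]) &
    forall u w, w <> [::] -> (size (u ++ w) < n)%N -> ~ Compat (b u ++ b (u ++ w))].

Variables (P : nat -> set_system (seq A)) (R : seq (level A) -> set_system (seq A)).
Hypothesis tR : tower P R.
Local Notation dom F := (R F setT).
Let cR : coherent R := tR.

(** For [c] blocks of [l] levels, one list of blocks is tested: all the blocks,
    repeated [r] times.  It contains all lists of at most [r] of these blocks. *)
Definition compatible_blocks l c r : Prop := exists Bs : seq (seq (level A)), [/\ size Bs = c,
  all (fun B => size B == l) Bs, dom (flatten Bs) &
  product [seq R B | B <- flatten (nseq r Bs)] [set cs | Compat (flatten cs)]].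

Lemma dom_blocks (Bs : seq (seq (level A))) B : dom (flatten Bs) -> B \in Bs -> dom B.
Proof.
move=> dB BBs; apply: (dom_subseq cR _ dB).
by have := @subseq_flatten _ [:: B] Bs; rewrite sub1seq /= cats0; apply.
Qed.

Lemma Compat_subseq (Gs Hs : seq (seq (level A))) :
  {in Hs, forall G, dom G} -> subseq Gs Hs ->
  product [seq R B | B <- Hs] [set cs | Compat (flatten cs)] ->
  product [seq R B | B <- Gs] [set cs | Compat (flatten cs)].
Proof.
move=> dH GH.
suff H D E : (forall cs cs' : seq (seq A), subseq cs cs' -> D cs' -> E cs) ->
    product [seq R B | B <- Hs] D -> product [seq R B | B <- Gs] E.
  apply: H => cs cs' /subseq_flatten/mem_subseq; exact: Compat_sub.
elim: Hs Gs dH GH D E => [|H Hs IH] Gs dH GH D E DE.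
  by move: GH => /eqP -> /= D0; apply: DE D0.
have dHs : {in Hs, forall G, dom G}.
  by move=> G Gs'; apply: dH; rewrite in_cons Gs' orbT.
have pH := dom_filter cR (dH _ (mem_head _ _)).
case: Gs GH => [|G Gs] GH /=.
  move=> /filter_ex[c Dc].
  apply: (IH [::] dHs (sub0seq _) _ _ _ Dc) => cs cs' css; apply: DE.
  exact: subseq_trans css (subseq_cons _ _).
move: GH; rewrite /=; case: eqP => [->|_] GH.
  apply: filterS => c; apply: IH => // cs cs' css; apply: DE.
  by rewrite /= eqxx.
move=> /filter_ex[c Dc].
apply: (IH (G :: Gs) dHs GH _ _ _ Dc) => cs cs' css; apply: DE.
exact: subseq_trans css (subseq_cons _ _).
Qed.

(** If blocks of double size are incompatible, let this be witnessed by all sequences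
    of [c] of them repeated [r] times.  Take [c] groups of [n + 1] blocks of the
    given size, and one tree for each of the [r * c] positions, whose levels are
    the blocks of the corresponding group.  A word selects one chain in each of
    these trees.  Two comparable words select, in each tree, two blocks of its
    group on the same branch, that is a chain of double length, so that together
    they realize the incompatible sequence; an antichain of words selects an
    antichain of chains meeting one block each. *)
Lemma compatible_blocks_step l : (forall c r, compatible_blocks l.+1 c r) ->
  (forall c r, compatible_blocks (l.+1 + l.+1) c r) \/
  exists s, forall n, antichain_pattern s n.+1.
Proof.
move=> thl; apply: contrapT => /not_orP[/existsNP[c /existsNP[r nth2]] npat].
apply: npat; exists (r * c * l.+1)%N => n; set h := n.+1.
(* the group of the tree at each position *)
pose groups := flatten (nseq r (iota 0 c)).
have sis : size groups = (r * c)%N.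
  by rewrite size_flatten /shape map_nseq size_iota sumn_nseq mulnC.
have isP : {in groups, forall g, (g < c)%N}.
  by move=> g /flattenP[s /nseqP[-> _]]; rewrite mem_iota.
(* enough repetitions for every antichain selected in all the trees *)
have [Bs [sBs Bsl dBs BsC]] := thl (c * h)%N (size groups * 2 ^ h)%N.
pose ws g := take h (drop (g * h) Bs).
have ws_size g : (g < c)%N -> size (ws g) = h.
  move=> gc; rewrite /ws size_take size_drop sBs -mulnBl.
  by case: ltnP => // H; apply/eqP; rewrite eqn_leq H leq_pmull // subn_gt0.
have ws_sub g : subseq (ws g) Bs.
  by apply: subseq_trans (take_subseq _ _) (drop_subseq _ _).
have ws_l g : all (fun B => size B == l.+1) (ws g).
  by apply/allP => B /(mem_subseq (ws_sub g)) /(allP Bsl).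
have ws_dom g : dom (flatten (ws g)).
  by apply: (dom_subseq cR _ dBs); exact/subseq_flatten.
pose T g := trees R 2 (flatten (ws g)).
have TF g : Filter (T g) by exact: trees_filter.
have TP g : (g < c)%N -> ProperFilter (T g).
  move=> gc; split; last exact: TF.
  apply: (tower_good tR (ws_dom g)) => // F0.
  by have := size_flatten_blocks (ws_l g); rewrite F0 ws_size.
pose TT := product [seq T g | g <- groups].
have TTP : ProperFilter TT.
  by apply: product_proper => f /mapP[g /isP gc ->]; exact: TP.
pose b (ts : seq (tree A)) w := flatten [seq block l.+1 w t | t <- ts].
have anti : TT [set ts | {in all_antichain_words h, forall L, (exists Y, L = antichain_words h Y) ->
    Compat (flatten [seq b ts w | w <- L])}].
  apply: filter_all => L _.
  have [[Y ->]|nY] := EM (exists Y, L = antichain_words h Y); last first.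
    by apply: filterE => ts LY; case: (nY LY).
  pose Phi (t : tree A) := [seq block l.+1 w t | w <- antichain_words h Y].
  pose Gs g := [seq nth [::] (ws g) (size w) | w <- antichain_words h Y].
  have fol : follows R TT (fun ts => flatten [seq Phi t | t <- ts])
      (flatten [seq Gs g | g <- groups]).
    apply: follows_product => g /isP gc; split; first exact: TF.
    have := follows_antichain (Y := Y) cR (ws_l g) (ws_dom g).
    by rewrite ws_size //; exact.
  have : product [seq R B | B <- flatten [seq Gs g | g <- groups]] [set cs | Compat (flatten cs)].
    apply: Compat_subseq BsC.
      by move=> G /flattenP[Gs' /nseqP[-> _]]; exact: dom_blocks.
    apply: subseq_repeat.
      move=> G /flattenP[_ /mapP[g /isP gc ->]] /mapP[w /antichain_words_short wh ->].
      by apply/(mem_subseq (ws_sub g))/mem_nth; rewrite ws_size.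
    rewrite size_flatten /shape -map_comp.
    elim: (groups) => //= g s IHs; rewrite mulSn leq_add // /Gs size_map.
    exact: size_antichain_words.
  move=> /fol; apply: filterS => ts /= CY _; apply: Compat_sub CY.
  move=> x /flattenP[_ /mapP[w wY ->] /flattenP[_ /mapP[t tts ->] xb]].
  apply/flattenP; exists (block l.+1 w t) => //.
  by apply/flattenP; exists (Phi t); apply: map_f.
have pairs : TT [set ts | {in words h, forall u, {in words h, forall w, w <> [::] ->
    (size (u ++ w) < h)%N -> ~ Compat (b ts u ++ b ts (u ++ w))}}].
  apply: filter_all => u _; apply: filter_all => w _.
  have [->|/eqP w0] := eqVneq w [::]; first exact: filterE.
  have [uwh|uwh] := ltnP (size (u ++ w)) h; last exact: filterE.
  pose G g := nth [::] (ws g) (size u) ++ nth [::] (ws g) (size (u ++ w)).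
  pose Phi (t : tree A) := [:: block l.+1 u t ++ block l.+1 (u ++ w) t].
  have fol : follows R TT (fun ts => flatten [seq Phi t | t <- ts])
      (flatten [seq [:: G g] | g <- groups]).
    apply: follows_product => g /isP gc; split; first exact: TF.
    by apply: follows_pair => //; rewrite ws_size.
  have GE : flatten [seq [:: G g] | g <- groups] = flatten (nseq r [seq G g | g <- iota 0 c]).
    by rewrite flatten_map1 /groups map_flatten map_nseq.
  have G_dom : dom (flatten [seq G g | g <- iota 0 c]).
    apply: (dom_subseq cR _ dBs).
    apply: (subseq_trans (y := flatten [seq flatten (ws g) | g <- iota 0 c])).
      apply: subseq_flatten_map => g.
      have [gc|gc] := ltnP (size (u ++ w)) (size (ws g)).
        have := @subseq_pair _ [::] (ws g) (size u) (size (u ++ w)).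
        rewrite gc andbT size_cat -{1}[size u]addn0 ltn_add2l.
        have -> : (0 < size w)%N by case: (w) w0.
        by move=> /(_ isT)/subseq_flatten; rewrite /= cats0 /G size_cat.
      rewrite /G [nth _ _ (size (u ++ w))]nth_default // cats0.
      have [uc|uc] := ltnP (size u) (size (ws g)); last by rewrite nth_default ?sub0seq.
      have := @subseq_flatten _ [:: nth [::] (ws g) (size u)] (ws g).
      by rewrite sub1seq /= cats0; apply; exact: mem_nth.
    rewrite -[X in subseq X _]/(flatten [seq flatten (ws g) | g <- iota 0 c]).
    have -> : flatten [seq flatten (ws g) | g <- iota 0 c] =
        flatten (flatten [seq ws g | g <- iota 0 c]).
      by elim: (iota 0 c) => //= g s ->; rewrite flatten_cat.
    by rewrite flatten_groups; apply/subseq_flatten/take_subseq.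
  have : product [seq R B | B <- flatten [seq [:: G g] | g <- groups]]
      [set cs | ~ Compat (flatten cs)].
    have := @product_ultra _ [seq R B | B <- flatten [seq [:: G g] | g <- groups]]
      [set cs | Compat (flatten cs)].
    case => //.
      move=> f /mapP[B]; rewrite GE => /flattenP[_ /nseqP[-> _]] BG ->.
      exact/(coh_ultra cR)/(dom_blocks G_dom BG).
    rewrite GE => CG; exfalso; apply: nth2.
    exists [seq G g | g <- iota 0 c]; split=> //.
      by rewrite size_map size_iota.
    apply/allP => B /mapP[g gi ->]; move: gi; rewrite mem_iota => /andP[_ gc].
    have sz i : (i < h)%N -> size (nth [::] (ws g) i) = l.+1.
      by move=> ih; apply/eqP/(allP (ws_l g))/mem_nth; rewrite ws_size.
    rewrite size_cat !sz //.
    by apply: leq_ltn_trans uwh; rewrite size_cat leq_addr.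
  move=> /fol; apply: filterS => ts /= nC _ _ CC; apply: nC; apply: Compat_sub CC.
  move=> x; rewrite flatten_map1 => /flattenP[_ /mapP[t tts ->]].
  rewrite mem_cat => /orP[] xb; rewrite mem_cat; apply/orP; [left|right];
    apply/flattenP; [exists (block l.+1 u t)|exists (block l.+1 (u ++ w) t)] => //;
    exact: map_f.
have sizes : TT [set ts | size ts = (r * c)%N].
  have H : {in [seq T g | g <- groups], forall f, Filter f} by move=> f /mapP[g _ ->].
  by have := product_size H; rewrite size_map sis.
have [ts [[Canti Cpairs] sts]] := filter_ex (filterI (filterI anti pairs) sizes).
exists (b ts); split.
- move=> w; rewrite /b -sts; elim: (ts) => //= t s IHs.
  by rewrite size_cat size_block IHs mulSn.
- by move=> Y; apply: Canti; [exact: antichain_words_all|exists Y].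
move=> u w w0 uwh; apply: Cpairs => //; rewrite mem_words;
  apply: leq_ltn_trans uwh; rewrite size_cat; [exact: leq_addr|exact: leq_addl].
Qed.

End Patterns.

(** * From a chain of root extensions to antichain patterns *)

Section Final.
Variables (A : eqType) (Compat : set (seq A)).
Hypothesis Compat_sub : forall l l' : seq A, {subset l <= l'} -> Compat l' -> Compat l.
Variable P : nat -> set_system (seq A).
Hypothesis bP : chain_filters P.

Section Base.
Variable R : seq (level A) -> set_system (seq A).
Hypothesis tR : tower P R.
Let cR : coherent R := tR.
Local Notation dom F := (R F setT).
Variable q : set (set A).
Hypothesis qdom : forall j : nat, dom [:: (q, j)].

Lemma label_ultra : UltraFilter q.
Proof.
have U := coh_ultra cR (qdom 0).
have [[|a0 l0] [//= _ _]] := filterI_ex _ (coh_size cR (qdom 0)) (qdom 0).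
have -> : q = [set B | R [:: (q, 0%N)] [set pi | B (head a0 pi)]].
  by apply/seteqP; split=> B; rewrite /= (tower_level tR _ (qdom 0)).
apply: ultra_decide => B.
exact: (in_ultra_setVsetC [set pi | B (head a0 pi)] U).
Qed.

Lemma label_chain C : P 1 C -> q [set z | C [:: z]].
Proof.
by move=> PC; apply/(tower_level tR C (qdom 0)); apply: (tower_chain tR (qdom 0)).
Qed.

(** The labels come in an order that depends on the tower, so that only the number of
    levels can be prescribed. *)
Lemma constant_levels c : exists F, [/\ dom F, size F = c & {in F, forall s, s.1 = q}].
Proof.
pose L := [seq (q, j) | j <- iota 0 c] : seq (level A).
have [H [dH LH]] : exists H, dom H /\ {subset L <= H}.
  rewrite /L {L}; elim: c => [|c [H [dH LH]]].
    exists [::]; split=> //; apply: (dom_subseq cR _ (qdom 0)); exact: sub0seq.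
  have [H' [dH' HH' cH']] := tower_dir tR dH (qdom c).
  exists H'; split=> // s; rewrite -addn1 iotaD map_cat mem_cat => /orP[/LH/(mem_subseq HH')//|].
  by rewrite /= inE => /eqP ->; apply: (mem_subseq cH'); rewrite mem_head.
exists [seq s <- H | s \in L]; split.
- by apply: (dom_subseq cR _ dH); exact: filter_subseq.
- have uL : uniq L by rewrite map_inj_uniq ?iota_uniq // => i j [].
  have -> : c = size L by rewrite size_map size_iota.
  apply/esym/perm_size/uniq_perm => //; first exact/filter_uniq/(tower_uniq tR).
  move=> s; rewrite mem_filter; case sL : (s \in L) => //=.
  by rewrite (LH _ sL).
- by move=> s; rewrite mem_filter => /andP[/mapP[j _ ->]].
Qed.

Lemma compatible_blocks_base : (forall N, product (nseq N q) Compat) ->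
  forall c r, compatible_blocks Compat R 1 c r.
Proof.
move=> qC c r; have [F [dF sF Fq]] := constant_levels c.
exists [seq [:: s] | s <- F]; split.
- by rewrite size_map.
- by apply/allP => B /mapP[s _ ->].
- by rewrite flatten_seq1.
suff H (Fs : seq (level A)) D : {in Fs, forall s, s.1 = q /\ dom [:: s]} ->
    product (nseq (size Fs) q) (fun l => D [seq [:: z] | z <- l]) ->
    product [seq R B | B <- [seq [:: s] | s <- Fs]] D.
  have -> : flatten (nseq r [seq [:: s] | s <- F]) = [seq [:: s] | s <- flatten (nseq r F)].
    by rewrite map_flatten map_nseq.
  apply: H.
    move=> s /flattenP[_ /nseqP[-> _] sF']; split; first exact: Fq.
    by apply: (dom_subseq cR _ dF); rewrite sub1seq.
  have qU := label_ultra.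
  have qF : {in nseq (size (flatten (nseq r F))) q, forall f, Filter f}.
    by move=> f /nseqP[-> _]; exact: filter_filter.
  by apply: productS (qC _) => // l; rewrite /= flatten_seq1.
elim: Fs D => [//|s Fs IH] D FsP /=.
have [sq ds] := FsP _ (mem_head _ _).
move=> qD; apply/(tower_level tR _ ds); rewrite sq.
have qU := label_ultra.
apply: filterS qD => z; apply: IH => s' s's; apply: FsP.
by rewrite in_cons s's orbT.
Qed.

End Base.

(** Starting from blocks of size one, the size is doubled until it exceeds [k]: then
    a single chain is already incompatible. *)
Theorem antichain_patterns :
  (exists k, forall k', (k <= k')%N -> P k' (~` Compat)) ->
  (forall q, UltraFilter q -> (forall C, P 1 C -> q [set z | C [:: z]]) ->
     forall N, product (nseq N q) Compat) ->
  exists s, forall n, antichain_pattern Compat s n.+1.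
Proof.
move=> [k kC] qC; have [R [tR [q qdom]]] := constant_tower bP.
have qU := label_ultra tR qdom.
have base := compatible_blocks_base tR qdom (qC q qU (label_chain tR qdom)).
apply: contrapT => nopat.
have cR : coherent R := tR.
have all_thick j : forall c r, compatible_blocks Compat R (2 ^ j) c r.
  elim: j => [//|j IH]; rewrite expnS mul2n -addnn.
  have e : (2 ^ j = (2 ^ j).-1.+1)%N by rewrite prednK // expn_gt0.
  rewrite e in IH *.
  by have [] := compatible_blocks_step Compat_sub tR IH.
have [Bs [sBs Bsl dB BC]] := all_thick k 1%N 1%N.
case: Bs sBs Bsl dB BC => [//|B [|//]] _ /andP[/eqP sB _] dB BC.
rewrite /= cats0 in dB BC.
have pB := dom_filter cR dB.
have : P (size B) (~` Compat) by apply: kC; rewrite sB ltnW // ltn_expl.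
move=> /(tower_chain tR dB) nBC.
by have [c []] := filterI_ex pB BC nBC; rewrite /= cats0.
Qed.

End Final.

(** * Definable sets *)

Section Syntax.
Variable L : signature.

Lemma tvars_trename V W (g : V -> W) (t : term L V) :
  tvars (trename g t) = g @` tvars t.
Proof.
elim: t => [v|f ts IH] /=; first by rewrite image_set1.
apply/seteqP; split=> w /=.
  by case=> i; rewrite IH => -[v tv <-]; exists v => //; exists i.
by case=> v [i tv] <-; exists i; rewrite IH; exists v.
Qed.

Lemma fvars_rename V W (g : V -> W) (phi : formula L V) :
  fvars (rename g phi) = g @` fvars phi.
Proof.
elim: phi W g => {V} [V|V s t|V r ts|V p IHp q IHq|V p IHp] W g /=.
- by rewrite image_set0.
- by rewrite !tvars_trename image_setU.
- apply/seteqP; split=> w /=.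
    by case=> i; rewrite tvars_trename => -[v tv <-]; exists v => //; exists i.
  by case=> v [i tv] <-; exists i; rewrite tvars_trename; exists v.
- by rewrite IHp IHq image_setU.
- rewrite IHp; apply/seteqP; split=> w /=.
    by case=> -[v|] // pv [<-]; exists v.
  by case=> v pv <-; exists (Some v).
Qed.

Variable N : structure L.

Lemma eval_trename V W (g : V -> W) (t : term L V) (e : W -> N) :
  eval e (trename g t) = eval (e \o g) t.
Proof. by elim: t => [//|f ts IH] /=; congr ifunc; apply/funext => i; exact: IH. Qed.

Lemma sat_rename V W (g : V -> W) (phi : formula L V) (e : W -> N) :
  sat (rename g phi) e <-> sat phi (e \o g).
Proof.
elim: phi W g e => {V} [V|V s t|V r ts|V p IHp q IHq|V p IHp] W g e //=.
- by rewrite !eval_trename.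
- by under eq_fun do rewrite eval_trename.
- by rewrite IHp IHq.
- have E d : scons d e \o omap g = scons d (e \o g) by apply/funext => -[].
  by split=> H d; have := H d; rewrite IHp E.
Qed.

Lemma eval_ext V (t : term L V) (e e' : V -> N) :
  (forall v, tvars t v -> e v = e' v) -> eval e t = eval e' t.
Proof.
elim: t => [v|f ts IH] /= ee; first exact: ee.
by congr ifunc; apply/funext => i; apply: IH => v tv; apply: ee; exists i.
Qed.

Lemma sat_ext V (phi : formula L V) (e e' : V -> N) :
  (forall v, fvars phi v -> e v = e' v) -> sat phi e <-> sat phi e'.
Proof.
elim: phi e e' => {V} [V|V s t|V r ts|V p IHp q IHq|V p IHp] e e' ee //=.
- by rewrite (eval_ext (e' := e')) ?(@eval_ext _ t e e') // => v tv; apply: ee; [right|left].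
- suff -> : (fun i => eval e (ts i)) = (fun i => eval e' (ts i)) by [].
  by apply/funext => i; apply: eval_ext => v tv; apply: ee; exists i.
- by rewrite (IHp e e') ?(IHq e e') // => v tv; apply: ee; [right|left].
- have E d v : fvars p v -> scons d e v = scons d e' v.
    by case: v => //= v pv; exact: ee.
  by split=> H d; have := H d; rewrite (IHp _ _ (E d)).
Qed.

End Syntax.

Section Definable.
Variables (L : signature) (N : structure L).
Implicit Types (B : set N).

(** Working with definable sets instead of formulas makes the bookkeeping of variables
    invisible. *)
Definition definable B (V : Type) (D : set (V -> N)) : Prop :=
  exists2 phi : pformula N V, formulas_over B phi & forall a, psat phi a <-> D a.

Lemma definable_psat B V (phi : pformula N V) :
  formulas_over B phi -> definable B (psat phi).
Proof. by exists phi. Qed.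

Lemma definableS B B' V (D : set (V -> N)) :
  B `<=` B' -> definable B D -> definable B' D.
Proof. by move=> BB [phi oB H]; exists phi => // c /oB/BB. Qed.

Lemma definable_not B V (D : set (V -> N)) : definable B D -> definable B (~` D).
Proof.
move=> [phi oB H]; exists (Not phi); first by move=> c /= [/oB|].
by move=> a /=; split=> [nD /H|nD /H].
Qed.

Lemma definable_and B V (D E : set (V -> N)) :
  definable B D -> definable B E -> definable B (D `&` E).
Proof.
move=> [phi oB H] [psi oB' H']; exists (Not (Imp phi (Not psi))).
  by move=> c /= [[/oB|[/oB'|]]|].
move=> a; split=> /=.
  by move=> H1; split; apply: contrapT => nD; apply: H1 => /H // _ /H'.
by move=> [/H Da /H' Ea]; apply.
Qed.

Lemma definable_true B V : definable B [set: V -> N].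
Proof.
exists (Not Bot); first by move=> c /= [|].
by move=> a; split=> // _; rewrite /psat /=.
Qed.

Lemma definable_all_in B V (I : eqType) (r : seq I) (D : I -> set (V -> N)) :
  (forall i, definable B (D i)) -> definable B [set a | {in r, forall i, D i a}].
Proof.
move=> dD; elim: r => [|i r IH].
  have -> : [set a | {in [::], forall i, D i a}] = setT by apply/seteqP; split.
  exact: definable_true.
have -> : [set a | {in i :: r, forall j, D j a}] = D i `&` [set a | {in r, forall j, D j a}].
  apply/seteqP; split=> a /=.
    move=> H; split=> [|j jr]; apply: H; rewrite in_cons ?eqxx // jr orbT //.
  by move=> [Di Dr] j; rewrite in_cons => /orP[/eqP ->|/Dr].
exact: definable_and.
Qed.

(** A variable is replaced by another one or by a parameter. *)
Lemma definable_subst B V W (g : V -> W + N) (D : set (V -> N)) :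
  (forall v c, g v = inr c -> B c) -> definable B D ->
  definable B [set a : W -> N | D (fun v => penv a (g v))].
Proof.
move=> gB [phi oB H].
exists (rename (fun v => match v with inl v => g v | inr c => inr c end) phi).
  move=> c; rewrite fvars_rename => -[[v|c'] /= pv]; first exact: gB.
  by move=> [<-]; exact: oB.
move=> a /=; rewrite /psat sat_rename -H /psat.
suff -> : penv a \o (fun v => match v with inl v => g v | inr c => inr c end) =
  penv (fun v => penv a (g v)) by [].
by apply/funext => -[].
Qed.

Lemma definable_reindex B V W (g : V -> W) (D : set (V -> N)) :
  definable B D -> definable B [set a : W -> N | D (a \o g)].
Proof. exact: (@definable_subst B V W (fun v => inl (g v))). Qed.

Lemma definable_forall B V (D : set (option V -> N)) :
  definable B D -> definable B [set a | forall d, D (scons d a)].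
Proof.
move=> [phi oB H].
pose g (v : option V + N) := match v with
  | inl None => None | inl (Some v) => Some (inl v) | inr c => Some (inr c) end.
exists (All (rename g phi)).
  move=> c /=; rewrite fvars_rename => -[[[v|]|c'] //= pc [<-]]; exact: oB.
move=> a; rewrite /psat /=.
have E d : scons d (penv a) \o g = penv (scons d a) by apply/funext => -[[v|]|].
by split=> K d; have := K d; rewrite sat_rename E; move/H.
Qed.

Lemma definable_exists B V (D : set (option V -> N)) :
  definable B D -> definable B [set a | exists d, D (scons d a)].
Proof.
move=> /definable_not/definable_forall/definable_not.
congr definable; apply/seteqP; split=> a /=.
  by move=> /existsNP[d /contrapT Dd]; exists d.
by move=> [d Dd] /(_ d).
Qed.

Definition pair_env V W (a : V -> N) (b : W -> N) : V + W -> N :=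
  fun v => match v with inl v => a v | inr w => b w end.

Definition fcons n (d : N) (x : 'I_n -> N) : 'I_n.+1 -> N :=
  fun i => if unlift ord0 i is Some j then x j else d.

Lemma fconsE n (x : 'I_n.+1 -> N) : x = fcons (x ord0) (x \o lift ord0).
Proof. by apply/funext => i; rewrite /fcons; case: unliftP => [j|] ->. Qed.

(** Moves the first variable of a tuple to the place bound by a quantifier. *)
Definition pull_var n V (v : 'I_n.+1 + V) : option ('I_n + V) :=
  match v with
  | inl i => if unlift ord0 i is Some j then Some (inl j) else None
  | inr v => Some (inr v) end.

Lemma pull_varE n V d (x : 'I_n -> N) (a : V -> N) :
  pair_env (fcons d x) a = scons d (pair_env x a) \o @pull_var n V.
Proof. by apply/funext => -[i|//]; rewrite /= /fcons; case: unlift. Qed.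

Lemma definable_existsn B n V (D : set ('I_n + V -> N)) :
  definable B D -> definable B [set a | exists x, D (pair_env x a)].
Proof.
elim: n D => [|n IH] D dD.
  have nil : 'I_0 -> N by case.
  have := @definable_subst B _ V (fun v : 'I_0 + V => match v with
    inl i => inr (nil i) | inr v => inl v end) D.
  have H (v : 'I_0 + V) (c : N) :
      match v with inl i => inr (nil i) | inr v => inl v end = inr c -> B c.
    by case: v => // -[].
  move=> /(_ H dD); congr definable; apply/seteqP; split=> a /=.
    by move=> Da; exists nil; move: Da; congr D; apply/funext => -[].
  by move=> [x]; congr D; apply/funext => -[[]|].
have := IH _ (definable_exists (definable_reindex (@pull_var n V) dD)).
congr definable; apply/seteqP; split=> a /=.
  by move=> [x [d Dd]]; exists (fcons d x); rewrite pull_varE.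
by move=> [x]; rewrite [x]fconsE pull_varE; exists (x \o lift ord0), (x ord0).
Qed.

End Definable.

(** * Smallness, elementary submodels and saturation *)

Lemma infinite_setU1_card (T : Type) (A : set T) (c : T) :
  infinite_set A -> A `|` [set c] #<= A.
Proof.
elim/Ppointed: T => T in A c *; first by rewrite emptyE.
move=> Ainf; have [Ac|nAc] := EM (A c).
  by rewrite (_ : A `|` [set c] = A) //; apply/seteqP; split=> x; [case=> // ->|left].
have /infiniteP/pcard_leP[i] := Ainf.
have iA n : A (i n) by apply: (@funS _ _ _ _ i).
have iI : injective i by move=> x y; apply: (@inj _ _ _ i); rewrite inE.
pose f x := if pselect (x = c) is left _ then i 0%N else
  if pselect (exists n, x = i n) is left e then i (projT1 (cid e)).+1 else x.
have fc : f c = i 0%N by rewrite /f; case: pselect.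
have fi n : f (i n) = i n.+1.
  rewrite /f; case: pselect => [e|_]; first by case: nAc; rewrite -e.
  case: pselect => [e|]; last by case; exists n.
  by case: cid => m /= e'; rewrite (iI _ _ e').
have fx x : A x -> (forall n, x <> i n) -> f x = x.
  move=> Ax xi; rewrite /f; case: pselect => [e|_]; first by case: nAc; rewrite -e.
  by case: pselect => [[n xn]|//]; case: (xi n).
have cases x : A x -> (exists n, x = i n) \/ (f x = x /\ forall n, x <> i n).
  move=> Ax; have [|/forallNP xi] := EM (exists n, x = i n); first by left.
  by right; split=> //; exact: fx.
have fA : f @` (A `|` [set c]) `<=` A.
  move=> _ [x [Ax|->] <-]; last by rewrite fc; exact: iA.
  by have [[n ->]|[-> _]] := cases _ Ax; rewrite // fi; exact: iA.
have fI : set_inj (A `|` [set c]) f.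
  move=> x y; rewrite !inE => -[Ax|->] [Ay|->] //.
  - have [[n ->]|[-> xi]] := cases _ Ax; have [[k ->]|[-> yi]] := cases _ Ay; rewrite ?fi //.
    + by move=> /iI/succn_inj ->.
    + by move=> /esym /yi.
    + by move=> /xi.
  - have [[n ->]|[-> xi]] := cases _ Ax; rewrite fc ?fi; first by move=> /iI.
    by move=> /xi.
  - have [[n ->]|[-> xi]] := cases _ Ay; rewrite fc ?fi; first by move=> /iI.
    by move=> /esym /xi.
have := inj_card_eq fI; rewrite card_eq_le => /andP[_ H].
exact: card_le_trans H (subset_card_le fA).
Qed.

Lemma card_lt_setU_finite (T K : Type) (A B : set T) :
  card_lt [set: nat] K -> card_lt A K -> finite_set B -> card_lt (A `|` B) K.
Proof.
move=> [natK Knat] [AK KA] Bfin.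
have [Afin|Ainf] := EM (finite_set A).
  have ABfin : finite_set (A `|` B) by rewrite finite_setU.
  have ABn : A `|` B #<= [set: nat].
    by apply: finite_set_countable.
  split; first exact: card_le_trans ABn natK.
  by move=> /card_le_trans/(_ ABn).
suff H : A `|` B #<= A.
  split; first exact: card_le_trans H AK.
  by move=> /card_le_trans/(_ H).
have [s ->] := (@finite_seqP {classic T} B).1 Bfin.
elim: s => [|c s IH].
  by rewrite (_ : [set` [::]] = set0) ?setU0 //; apply/seteqP; split.
have -> : A `|` [set` c :: s] = (A `|` [set` s]) `|` [set c].
  apply/seteqP; split=> x /=.
    case=> [Ax|]; first by left; left.
    by rewrite in_cons => /orP[/eqP ->|xs]; [right|left; right].
  by case=> [[Ax|xs]|->]; [left|right; rewrite in_cons xs orbT|right; rewrite mem_head].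
apply: card_le_trans IH; apply: infinite_setU1_card.
by apply: contra_not Ainf => /sub_finite_set; apply; left.
Qed.

Section Elementary.
Variables (L : signature) (N : structure L) (M : set N).
Hypothesis elM : elementary_submodel M.

(** Tarski and Vaught.  Parameters outside [M] do not occur in the formula and are
    sent to an arbitrary point of [M]. *)
Lemma definable_witness1 V (D : set (option V -> N)) (a : V -> N) :
  definable M D -> (forall v, M (a v)) ->
  (exists d, D (scons d a)) -> exists2 d, M d & D (scons d a).
Proof.
move=> [phi oM H] aM [d Dd]; have [M0 [Mf el]] := elM.
have [m0] := M0.
pose f (v : V + N) : induced M0 Mf := match v with
  | inl v => exist _ (a v) (aM v)
  | inr c => if pselect (M c) is left Mc then exist _ c Mc else m0 end.
pose g (v : option V + N) := match v with
  | inl None => None | inl (Some v) => Some (inl v) | inr c => Some (inr c) end.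
have E d' : sat (rename g phi) (scons d' (fun v => proj1_sig (f v))) <-> D (scons d' a).
  rewrite sat_rename -H /psat; apply: sat_ext => -[[v|]|c] //= /oM Mc.
  by case: pselect.
apply: contrapT => nD; have : sat (All (Not (rename g phi))) f.
  move=> d' /=; rewrite el => S; apply: nD; exists (proj1_sig d'); first exact: proj2_sig.
  by apply/E; move: S; congr sat; apply/funext => -[].
by rewrite el => /(_ d); apply; apply/E.
Qed.

Lemma definable_witness n V (D : set ('I_n + V -> N)) (a : V -> N) :
  definable M D -> (forall v, M (a v)) ->
  (exists x, D (pair_env x a)) -> exists2 x, (forall i, M (x i)) & D (pair_env x a).
Proof.
move=> + aM; elim: n D => [|n IH] D dD.
  by move=> [x Dx]; exists x => // -[].
move=> [x Dx].
have [] := IH _ (definable_exists (definable_reindex (@pull_var n V) dD)).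
  by exists (x \o lift ord0), (x ord0); rewrite /= -pull_varE -fconsE.
move=> x' x'M /(definable_witness1 (definable_reindex (@pull_var n V) dD))[|d dM Dd].
  by case.
exists (fcons d x'); last by rewrite pull_varE.
by move=> i; rewrite /fcons; case: unlift.
Qed.

End Elementary.

Section Saturation.
Variables (L : signature) (N : structure L) (K : Type).
Hypothesis satN : saturated N K.

(** Saturation for filters: extend to an ultrafilter, whose definable members form a
    complete type. *)
Lemma saturated_filter (B : set N) (W : finType) (G0 : set_system (W -> N)) :
  card_lt B K -> ProperFilter G0 ->
  exists a, forall D, definable B D -> G0 D -> D a.
Proof.
move=> Bsmall /ultraFilterLemma[G [GU G0G]].
pose ev (b : 'I_#|W| -> N) : W -> N := fun w => b (enum_rank w).
pose un (a : W -> N) : 'I_#|W| -> N := fun i => a (enum_val i).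
have evun a : ev (un a) = a by apply/funext => w; rewrite /ev /un enum_rankK.
pose p := [set phi : pformula N 'I_#|W| | formulas_over B phi /\ G [set a | psat phi (un a)]].
have pB : complete_type B p.
  split; first by move=> phi [].
    move=> F Ffin Fp.
    have [s sF] := (@finite_seqP {classic (pformula N 'I_#|W|)} F).1 Ffin.
    have : G [set a | {in s, forall phi : {classic (pformula N 'I_#|W|)},
        psat (phi : pformula N 'I_#|W|) (un a)}].
      by apply: filter_all => phi phis; have [] : p phi by apply: Fp; rewrite sF.
    move=> /filter_ex[a aP]; exists (un a); split=> // phi.
    by rewrite sF => /aP.
  move=> phi oB; have [GD|GD] := in_ultra_setVsetC [set a | psat phi (un a)] GU.
    by left.
  by right; split=> //= c [/oB|].
have [b bp] := satN Bsmall pB; exists (ev b) => D dD /G0G GD.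
have [phi oB H] := definable_reindex (@enum_rank W) dD.
apply/(H b); apply: bp; split=> //; apply: filterS GD => a Da.
by apply/H; rewrite /= -[_ \o _]/(ev (un a)) evun.
Qed.

End Saturation.

Lemma card_lt_set0 (T K : Type) : card_lt [set: nat] K -> card_lt (@set0 T) K.
Proof.
move=> [natK _]; split; first exact: card_ge0.
by move=> /(card_le_trans natK); rewrite card_le0 => /eqP/seteqP[/(_ 0%N I)].
Qed.

(** * Definable sets of lists, and invariant global types *)

Section Lists.
Variables (L : signature) (N : structure L) (m : nat).
Notation A := {classic ('I_m -> N)}.
Variable d0 : A.
Implicit Types (B : set N) (pi : seq A) (C : set (seq A)).

Definition tuple_env n pi : 'I_n * 'I_m -> N := fun ij => (nth d0 pi ij.1 : 'I_m -> N) ij.2.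

Lemma tuple_env_cons n (z : A) pi :
  @tuple_env n.+1 (z :: pi) = fun ij => if unlift ord0 ij.1 is Some i then @tuple_env n pi (i, ij.2)
                               else (z : 'I_m -> N) ij.2.
Proof.
by apply/funext => -[i j] /=; case: unliftP => [i'|] -> //; rewrite /tuple_env /= lift0.
Qed.

(** Lists of length other than [n] are irrelevant. *)
Definition list_definable B n C : Prop := exists2 D : set ('I_n * 'I_m -> N), definable B D &
  forall pi, size pi = n -> C pi <-> D (tuple_env pi).

Lemma list_definable_ext B n C C' : (forall pi, size pi = n -> C pi <-> C' pi) ->
  list_definable B n C -> list_definable B n C'.
Proof. by move=> CC [D dD H]; exists D => // pi sp; rewrite -CC // H. Qed.

Lemma list_definable_not B n C : list_definable B n C -> list_definable B n (~` C).
Proof.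
move=> [D dD H]; exists (~` D); first exact: definable_not.
by move=> pi sp /=; rewrite H.
Qed.

Lemma list_definable_true B n : list_definable B n setT.
Proof. by exists setT => //; exact: definable_true. Qed.

Lemma list_definable_and B n C C' :
  list_definable B n C -> list_definable B n C' -> list_definable B n (C `&` C').
Proof.
move=> [D dD H] [D' dD' H']; exists (D `&` D'); first exact: definable_and.
by move=> pi sp; rewrite /= H // H'.
Qed.

Lemma list_definable_pick B n (ids : seq nat) C : all (fun i => i < n)%N ids ->
  list_definable B (size ids) C ->
  list_definable B n [set pi | C [seq nth d0 pi i | i <- ids]].
Proof.
move=> isn [D dD H].
have f_lt (i : 'I_(size ids)) : (nth 0 ids i < n)%N by apply: (allP isn); exact: mem_nth.
pose g (ij : 'I_(size ids) * 'I_m) := (Ordinal (f_lt ij.1), ij.2).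
exists [set a : 'I_n * 'I_m -> N | D (a \o g)]; first exact: definable_reindex.
move=> pi sp; rewrite /= H ?size_map //.
suff -> : @tuple_env (size ids) [seq nth d0 pi i | i <- ids] = @tuple_env n pi \o g by [].
by apply/funext => -[i j]; rewrite /tuple_env /= (nth_map 0%N).
Qed.

Lemma list_definable_mask B ms C : list_definable B (count id ms) C ->
  list_definable B (size ms) [set pi | C (mask ms pi)].
Proof.
have sms : size (mask ms (iota 0 (size ms))) = count id ms by rewrite size_mask // size_iota.
rewrite -sms => /list_definable_pick H; have := H (size ms).
have -> : all (fun i => i < size ms)%N (mask ms (iota 0 (size ms))).
  by apply/allP => i /mem_mask; rewrite mem_iota.
move=> /(_ isT); apply: list_definable_ext => pi sp /=.
by rewrite map_mask -sp map_nth_iota0 // take_size.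
Qed.

Lemma list_definable_param B n (c : A) C : (forall j, B ((c : 'I_m -> N) j)) ->
  list_definable B n.+1 C -> list_definable B n [set pi | C (c :: pi)].
Proof.
move=> cB [D dD H].
pose g (ij : 'I_n.+1 * 'I_m) : 'I_n * 'I_m + N :=
  if unlift ord0 ij.1 is Some i then inl (i, ij.2) else inr ((c : 'I_m -> N) ij.2).
exists [set a | D (fun v => penv a (g v))].
  apply: definable_subst dD => -[i j] d; rewrite /g.
  by case: unlift => [i'|] //= [<-].
move=> pi sp; rewrite /= H /= ?sp //.
suff -> : @tuple_env n.+1 (c :: pi) = fun v => penv (@tuple_env n pi) (g v) by [].
by rewrite tuple_env_cons; apply/funext => -[i j]; rewrite /g /=; case: unlift.
Qed.

Definition over_list B pi := forall (c : A) j, c \in pi -> B ((c : 'I_m -> N) j).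

Lemma list_definable_root B n pi C : size pi = n -> over_list B pi -> list_definable B n.+1 C ->
  definable B [set z : 'I_m -> N | C ((z : A) :: pi)].
Proof.
move=> sp piB [D dD H].
pose g (ij : 'I_n.+1 * 'I_m) : 'I_m + N :=
  if unlift ord0 ij.1 is Some i then inr (@tuple_env n pi (i, ij.2)) else inl ij.2.
have -> : [set z : 'I_m -> N | C ((z : A) :: pi)] = [set z | D (fun v => penv z (g v))].
  apply/seteqP; split=> z /=; rewrite H /= ?sp // tuple_env_cons;
    congr D; by apply/funext => -[i j]; rewrite /g /=; case: unlift.
apply: definable_subst dD => -[i j] d; rewrite /g.
case: unlift => // i' [<-]; apply: piB; rewrite mem_nth // sp; exact: ltn_ord.
Qed.

Lemma list_definable_exists B n C :
  list_definable B n.+1 C -> list_definable B n [set pi | exists z, C (z :: pi)].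
Proof.
move=> [D dD H].
pose g (ij : 'I_n.+1 * 'I_m) : 'I_m + 'I_n * 'I_m :=
  if unlift ord0 ij.1 is Some i then inr (i, ij.2) else inl ij.2.
exists [set a : 'I_n * 'I_m -> N | exists z : 'I_m -> N, D (pair_env z a \o g)].
  exact: (definable_existsn (definable_reindex g dD)).
move=> pi sp /=.
have E (z : 'I_m -> N) : C ((z : A) :: pi) <-> D (pair_env z (@tuple_env n pi) \o g).
  rewrite H /= ?sp // tuple_env_cons.
  suff -> : (fun ij : 'I_n.+1 * 'I_m => match unlift ord0 ij.1 with
    | Some i => @tuple_env n pi (i, ij.2) | None => (z : 'I_m -> N) ij.2 end) =
    pair_env z (@tuple_env n pi) \o g by [].
  by apply/funext => -[i j]; rewrite /g /=; case: unlift.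
by split=> -[z Ez]; exists z; [exact: (E z).1|exact: (E z).2].
Qed.

(** The latest element comes first, to match the order of branches from the root. *)
Fixpoint latest (s : nat -> A) n : seq A := if n is n'.+1 then s n' :: latest s n' else [::].

Lemma size_latest s n : size (latest s n) = n.
Proof. by elim: n => //= n ->. Qed.

Lemma mem_latest s n c : c \in latest s n <-> exists2 i, (i < n)%N & c = s i.
Proof.
elim: n => [|n IH] /=; first by split=> // -[].
rewrite in_cons; split.
  move=> /orP[/eqP ->|cl]; first by exists n.
  by have [i ilt ->] := IH.1 cl; exists i => //; exact: ltnW.
move=> [i]; rewrite ltnS leq_eqVlt => /orP[/eqP -> ->|ilt ci]; first by rewrite eqxx.
by apply/orP; right; apply: IH.2; exists i.
Qed.

Lemma nth_latest s n i : (i < n)%N -> nth d0 (latest s n) (n - i.+1) = s i.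
Proof.
elim: n => [//|n IH]; rewrite ltnS leq_eqVlt => /orP[/eqP ->|ilt]; first by rewrite subnn.
by rewrite subSS -(subnSK ilt) /= IH.
Qed.

End Lists.

Section GlobalType.
Variables (L : signature) (N : structure L) (m : nat).
Notation A := {classic ('I_m -> N)}.
Variable d0 : A.
Variables (M : set N) (p : set (pformula N 'I_m)).
Hypothesis gp : global_type p.

(** A global type as a filter; it decides the sets definable with parameters. *)
Definition type_filter : set_system A := [set D | exists2 phi, p phi & psat phi `<=` D].

Lemma type_filter_proper : ProperFilter type_filter.
Proof.
have [_ cons dec] := gp.
have dec' phi : p phi \/ p (Not phi) by apply: dec.
split.
  move=> [phi pphi phi0].
  have [_ ->//|c [_ H]] := cons [set phi] (finite_set1 _).
  exact: (phi0 _ (H phi erefl)).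
split.
- by have [pB|pB] := dec' Bot; [exists Bot|exists (Not Bot)].
- move=> D E [phi pphi phiD] [psi ppsi psiE].
  pose conj := Not (Imp phi (Not psi)).
  have conjE a : psat conj a <-> psat phi a /\ psat psi a.
    split=> [H|[Ha Hb]]; last by apply.
    by split; apply: contrapT => nH; apply: H => // Ha Hb.
  have [pc|pc] := dec' conj.
    by exists conj => // a /conjE[/phiD ? /psiE].
  have [_ [[->|->]|->]//|c [_ H]] := cons [set phi; psi; Not conj] (finite_set3 _ _ _).
  exfalso; apply: (H (Not conj)); first by right.
  by apply/conjE; split; apply: H; left; [left|right].
- by move=> D E DE [phi pphi phiD]; exists phi => // a /phiD/DE.
Qed.

Lemma type_filter_decide D : definable setT D -> type_filter D \/ type_filter (~` D).
Proof.
have [_ _ dec] := gp; move=> [phi _ H].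
have [pphi|pphi] : p phi \/ p (Not phi) by apply: dec.
  by left; exists phi => // a /H.
by right; exists (Not phi) => // a /= nphi /H.
Qed.

Lemma type_filterP phi : type_filter (psat phi) <-> p phi.
Proof.
have [_ cons dec] := gp; split=> [[psi ppsi H]|]; last by exists phi.
have [//|pn] : p phi \/ p (Not phi) by apply: dec.
have [_ [->|->]//|c [_ H']] := cons [set psi; Not phi] (finite_set2 _ _).
by exfalso; apply: (H' (Not phi)); [right|apply: H; apply: H'; left].
Qed.

Lemma psat_inst V W (chi : pformula N (V + W)) (b : W -> N) a :
  psat (inst chi b) a <-> psat chi (pair_env a b).
Proof.
rewrite /psat sat_rename.
suff -> : penv a \o (fun v => match v with
  | inl (inl x) => inl x | inl (inr y) => inr (b y) | inr c => inr c end) =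
  penv (pair_env a b) by [].
by apply/funext => -[[]|].
Qed.

Hypothesis invp : invariant_over M p.

Lemma type_filter_invariant n (pi pi' : seq A) C : size pi = n -> size pi' = n ->
  (forall C', list_definable d0 M n C' -> C' pi <-> C' pi') -> list_definable d0 M n.+1 C ->
  type_filter [set z | C (z :: pi)] -> type_filter [set z | C (z :: pi')].
Proof.
move=> sp sp' eqp [D dD H].
pose k := #|{: 'I_n * 'I_m}|.
pose g (ij : 'I_n.+1 * 'I_m) : 'I_m + 'I_k :=
  if unlift ord0 ij.1 is Some i then inr (enum_rank (i, ij.2)) else inl ij.2.
have [chi oM Hchi] := definable_reindex g dD.
pose b (pi : seq A) : 'I_k -> N := fun r => tuple_env d0 pi (enum_val r).
have E (pi0 : seq A) : size pi0 = n ->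
    [set z | C (z :: pi0)] = psat (inst chi (b pi0)).
  move=> s0; apply/seteqP; split=> z; rewrite psat_inst Hchi /= H /= ?s0 // tuple_env_cons;
  congr D; apply/funext => -[i j]; rewrite /g /=; case: unlift => //= i';
  by rewrite /b enum_rankK.
rewrite !E // !type_filterP; apply: (invp oM _).1.
have tpE phi : formulas_over M phi -> psat phi (b pi) <-> psat phi (b pi').
  move=> oM'; apply: (eqp [set pi | psat phi (b pi)]).
  exists [set a : 'I_n * 'I_m -> N | psat phi (a \o enum_val)] => //.
  exact: definable_reindex (definable_psat oM').
by apply/seteqP; split=> phi [oM' ph]; split=> //; apply/tpE.
Qed.

End GlobalType.

(** * The types of decreasing Morley sequences *)

Section Chains.
Variables (L : signature) (N : structure L) (m : nat).
Notation A := {classic ('I_m -> N)}.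
Variable d0 : A.
Variables (K : Type) (M : set N) (p : set (pformula N 'I_m)) (s : nat -> A).
Hypotheses (satN : saturated N K) (Msmall : card_lt M K) (elM : elementary_submodel M).
Hypotheses (gp : global_type p) (invp : invariant_over M p).
Hypothesis (ms : morley_seq_of M p (s : nat -> 'I_m -> N)).
Local Notation list_definable := (list_definable d0).

Lemma morley_realizes i D : definable (with_initial M (s : nat -> 'I_m -> N) i) D ->
  type_filter p D <-> D (s i).
Proof.
(* completeness of the type reduces the equivalence to one implication *)
have pF := type_filter_proper gp.
suff H E : definable (with_initial M (s : nat -> 'I_m -> N) i) E -> type_filter p E -> E (s i).
  move=> dD; split; first exact: H.
  have [//|pnD Ds] := type_filter_decide gp (definableS (@subsetT _ _) dD).
  by have := H _ (definable_not dD) pnD.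
move=> [phi oB HE] pE; apply/HE; apply: (ms (i := i)); split=> //.
apply/(type_filterP gp).
by apply: filterS pE => a /HE.
Qed.

Lemma over_latest n : over_list (with_initial M (s : nat -> 'I_m -> N) n) (latest s n).
Proof. by move=> c j /mem_latest[i ilt ->]; right; exists i, j. Qed.

Lemma definable_latest n (ks : seq bool) C : list_definable M (count id ks).+1 C ->
  size ks = n ->
  definable (with_initial M (s : nat -> 'I_m -> N) n)
    [set z : 'I_m -> N | C ((z : A) :: mask ks (latest s n))].
Proof.
move=> dC sk; apply: (list_definable_root (d0 := d0) (n := count id ks)).
- by rewrite size_mask // size_latest.
- by move=> c j /mem_mask; exact: over_latest.
- by have [D dD H] := dC; exists D => //; apply: definableS dD => c; left.
Qed.

(** Subsequences of an invariant Morley sequence have the type of its segments.  By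
    invariance the type of the latest element over the others only depends on
    their type over [M]. *)
Lemma morley_mask n (ks : seq bool) C : size ks = n -> list_definable M (count id ks) C ->
  C (mask ks (latest s n)) <-> C (latest s (count id ks)).
Proof.
elim: n ks C => [|n IH] [|k ks] C //=.
move=> [sk]; case: k => /= [|dC]; last exact: IH.
rewrite add1n => dC.
have dC0 := definable_latest dC sk.
have dC1 := definable_latest (ks := nseq (count id ks) true) (n := count id ks) (C := C).
rewrite count_nseq mul1n mask_true ?size_latest // in dC1.
have {}dC1 := dC1 dC (size_nseq _ _).
have e0 : _ <-> C (s n :: mask ks (latest s n)) := morley_realizes dC0.
have e1 : _ <-> C (s (count id ks) :: latest s (count id ks)) := morley_realizes dC1.
rewrite -e0 -e1.
have sz1 : size (mask ks (latest s n)) = count id ks by rewrite size_mask // size_latest.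
have sz2 := size_latest s (count id ks).
have inv := @type_filter_invariant _ _ _ d0 M p gp invp (count id ks).
by split; [apply: (inv _ _ _ sz1 sz2)|apply: (inv _ _ _ sz2 sz1)] => // C' dC'; rewrite IH.
Qed.

Definition in_model (pi : seq A) := forall (c : A) j, c \in pi -> M ((c : 'I_m -> N) j).

(** The type over [M] of a segment, as a filter of sets of lists of tuples of [M]. *)
Definition chain_type n : set_system (seq A) := [set C | exists E, [/\ list_definable M n E,
  E (latest s n) & forall pi, size pi = n -> in_model pi -> E pi -> C pi]].

(** Otherwise saturation gives [k] realizations of the type of [latest s n] without a
    common [z]; but by invariance all the conditions on [z] belong to the same
    global type. *)
Lemma common_root n k C : list_definable M n.+1 C -> C (latest s n.+1) ->
  exists D, [/\ list_definable M n D, D (latest s n) &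
   forall pis : seq (seq A), (size pis <= k)%N ->
     {in pis, forall pi, size pi = n /\ D pi} ->
     exists z, {in pis, forall pi, C (z :: pi)}].
Proof.
move=> dC Cs; apply: contrapT => nD.
have {}nD D : list_definable M n D -> D (latest s n) ->
    exists pis : seq (seq A), [/\ (size pis <= k)%N,
     {in pis, forall pi, size pi = n /\ D pi} &
     ~ exists z, {in pis, forall pi, C (z :: pi)}].
  move=> dD Ds; apply: contrapT => H; apply: nD; exists D; split=> // pis spis Dpis.
  by apply: contrapT => nz; apply: H; exists pis.
pose W : finType := ('I_k * ('I_n * 'I_m))%type.
have [D dD HD] := dC.
pose row (x : W -> N) (i : 'I_k) : 'I_n * 'I_m -> N := fun ij => x (i, ij).
pose g (i : 'I_k) (ij : 'I_n.+1 * 'I_m) : 'I_m + W :=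
  if unlift ord0 ij.1 is Some i' then inr (i, (i', ij.2)) else inl ij.2.
pose good (x : W -> N) := exists z, {in enum 'I_k, forall i, D (pair_env z x \o g i)}.
have dgood : definable M good.
  have dall := @definable_all_in _ _ M _ _ (enum 'I_k)
     (fun i => [set a : 'I_m + W -> N | D (a \o g i)]) (fun i => definable_reindex (g i) dD).
  exact: (definable_existsn dall).
pose large : set_system (W -> N) := [set X | exists E, [/\ definable M E,
  E (@tuple_env _ _ _ d0 n (latest s n)) & forall x, (forall i, E (row x i)) -> ~ good x -> X x]].
have padP (E : set ('I_n * 'I_m -> N)) : definable M E -> E (tuple_env d0 (latest s n)) ->
    exists x : W -> N, (forall i, E (row x i)) /\ ~ good x.
  move=> dE Es.
  have dE' : list_definable M n [set pi | E (@tuple_env _ _ _ d0 n pi)] by exists E.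
  have [pis [spis pisE nz]] := nD _ dE' Es.
  (* shorter lists are padded with copies of their first chain *)
  case: pis spis pisE nz => [|pi0 pis] spis pisE nz.
    by case: nz; exists d0.
  pose pi_ (i : 'I_k) := nth pi0 (pi0 :: pis) i.
  have pi_in i : pi_ i \in pi0 :: pis.
    have [ilt|ige] := ltnP i (size (pi0 :: pis)); first exact: mem_nth.
    by rewrite /pi_ nth_default // mem_head.
  exists (fun w => tuple_env d0 (pi_ w.1) w.2); split=> [i|].
    by have [_] := pisE _ (pi_in i).
  move=> [z zP]; apply: nz; exists z => pi pip.
  have ilt : (index pi (pi0 :: pis) < k)%N by apply: leq_trans spis; rewrite index_mem.
  have := zP (Ordinal ilt); rewrite mem_enum => /(_ isT).
  have pi_pi : pi_ (Ordinal ilt) = pi by rewrite /pi_ nth_index.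
  have [sp _] := pisE _ pip.
  have -> : pair_env z (fun w : W => tuple_env d0 (pi_ w.1) w.2) \o g (Ordinal ilt) =
      tuple_env d0 (z :: pi).
    rewrite tuple_env_cons; apply/funext => -[i j]; rewrite /g /=.
    by case: unlift => //= i'; rewrite pi_pi.
  by move=> Dz; apply/HD; rewrite /= ?sp.
have largeP : ProperFilter large.
  split.
    by move=> [E [dE Es H]]; have [x [Ex ngx]] := padP E dE Es; exact: (H x).
  split.
  - by exists setT; split=> //; exact: definable_true.
  - move=> X Y [E [dE Es H]] [E' [dE' Es' H']]; exists (E `&` E'); split=> //.
      exact: definable_and.
    by move=> x Ex ngx; split; [apply: H|apply: H'] => // i; have [] := Ex i.
  - by move=> X Y XY [E [dE Es H]]; exists E; split=> // x Ex ngx; apply/XY/H.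
have [x xP] := saturated_filter satN Msmall largeP.
have ngx : ~ good x.
  by apply: (xP _ (definable_not dgood)); exists setT; split=> //; exact: definable_true.
have rowP i E : definable M E -> E (tuple_env d0 (latest s n)) -> E (row x i).
  move=> dE Es; apply: (xP [set x | E (row x i)]).
    exact: (definable_reindex (fun ij => (i, ij))).
  by exists E; split=> // y Ey _; exact: Ey.
pose pi_ i : seq A := [seq (fun j => row x i (i', j)) | i' <- enum 'I_n].
have spi i : size (pi_ i) = n by rewrite size_map size_enum_ord.
have tupE i : tuple_env d0 (pi_ i) = row x i.
  apply/funext => -[i' j]; rewrite /tuple_env /pi_ /= (nth_map i') ?size_enum_ord //.
  by rewrite nth_ord_enum.
have dCs : definable (with_initial M (s : nat -> 'I_m -> N) n)
    [set z : 'I_m -> N | C ((z : A) :: latest s n)].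
  have := @definable_latest n (nseq n true) C.
  by rewrite count_nseq mul1n mask_true ?size_latest //; apply=> //; rewrite size_nseq.
have ps : type_filter p [set z : 'I_m -> N | C ((z : A) :: latest s n)].
  by apply/(morley_realizes dCs).
have pF := type_filter_proper gp.
have pall : type_filter p [set z : 'I_m -> N | {in enum 'I_k, forall i, C ((z : A) :: pi_ i)}].
  apply: filter_all => i _.
  apply: (type_filter_invariant (d0 := d0) gp invp (size_latest s n) (spi i) _ dC ps).
  move=> C' [D' dD' HD']; rewrite (HD' _ (size_latest s n)) (HD' _ (spi i)) tupE.
  split; first exact: rowP.
  move=> Dr; apply: contrapT => nDs.
  by have := rowP i _ (definable_not dD') nDs.
have [z zP] := filter_ex pall.
apply: ngx; exists z => i ik.
have := zP i ik; rewrite HD /= ?spi // tuple_env_cons.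
congr D; apply/funext => -[i' j]; rewrite /g /=.
by case: unlift => //= i''; rewrite tupE.
Qed.

Lemma in_model_witness n (pis : seq (seq A)) C : list_definable M n.+1 C ->
  {in pis, forall pi, size pi = n /\ in_model pi} ->
  (exists z : A, {in pis, forall pi, C (z :: pi)}) ->
  exists2 z : A, (forall j, M ((z : 'I_m -> N) j)) & {in pis, forall pi, C (z :: pi)}.
Proof.
move=> dC pisM [z0 z0P].
have dz : definable M [set z : 'I_m -> N | {in pis, forall pi, in_model pi -> size pi = n ->
    C ((z : A) :: pi)}].
  apply: (@definable_all_in _ _ M _ _ pis (fun pi => [set z : 'I_m -> N |
    in_model pi -> size pi = n -> C ((z : A) :: pi)])) => pi.
  have [[pM sp]|npM] := EM (in_model pi /\ size pi = n).
    have -> : [set z : 'I_m -> N | in_model pi -> size pi = n -> C ((z : A) :: pi)] =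
       [set z : 'I_m -> N | C ((z : A) :: pi)].
      by apply/seteqP; split=> z //=; apply.
    exact: (list_definable_root (d0 := d0)) dC.
  have -> : [set z : 'I_m -> N | in_model pi -> size pi = n -> C ((z : A) :: pi)] = setT.
    by apply/seteqP; split=> z // _ pM sp; case: npM.
  exact: definable_true.
have := definable_witness elM (n := m) (V := void)
  (definable_reindex (fun j => inl j) dz) (a := of_void N).
case=> //.
  exists z0 => pi pip _ _; have := z0P _ pip.
  by congr C; congr cons; apply/funext.
move=> z zM zP; exists z => // pi pip; have [sp pM] := pisM _ pip.
exact: (zP _ pip pM sp).
Qed.

Lemma chain_type_filters : chain_filters chain_type.
Proof.
split.
- move=> n; split.
  + by exists setT; split=> //; exact: list_definable_true.
  + move=> C D [E [dE Es H]] [E' [dE' Es' H']]; exists (E `&` E'); split=> //.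
      exact: list_definable_and.
    by move=> pi sp pM [? ?]; split; [apply: H|apply: H'].
  + by move=> C D CD [E [dE Es H]]; exists E; split=> // pi sp pM /(H _ sp pM)/CD.
- by move=> n; exists setT; split=> //; exact: list_definable_true.
- by move=> C [E [dE Es H]]; apply: H.
- move=> ks C [E [dE Es H]]; exists [set pi | E (mask ks pi)]; split.
  + exact: list_definable_mask.
  + by apply/morley_mask.
  + move=> pi sp pM; apply: H; first by rewrite size_mask.
    by move=> c j /mem_mask; exact: pM.
- move=> n k C [E [dE Es H]].
  have [D [dD Ds DP]] := common_root k dE Es.
  exists [set pi | [/\ size pi = n, in_model pi & D pi]].
    by exists D; split.
  move=> pis spis pisP.
  have pisM : {in pis, forall pi, size pi = n /\ in_model pi} by move=> pi /pisP[].
  have [|z zM zP] := in_model_witness dE pisM.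
    by apply: DP => // pi /pisP[].
  exists z => pi pip; have [sp pM] := pisM _ pip; apply: H; last exact: zP.
    by rewrite /= sp.
  by move=> c j; rewrite in_cons => /orP[/eqP ->|/pM].
Qed.

End Chains.

(** * Satisfiable instances, and coheirs as ultrafilters *)

Section Instances.
Variables (L : signature) (N : structure L) (n m : nat).
Notation A := {classic ('I_m -> N)}.
Variable d0 : A.
Variable phi : pformula N ('I_n + 'I_m).

Definition satisfiable : set (seq A) :=
  [set l | exists x : 'I_n -> N, {in l, forall c : A, psat phi (pair_env x (c : 'I_m -> N))}].

Lemma satisfiable_sub (l l' : seq A) :
  {subset l <= l'} -> satisfiable l' -> satisfiable l.
Proof. by move=> ll' [x xP]; exists x => c /ll'; exact: xP. Qed.

Lemma list_definable_satisfiable (M : set N) k :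
  formulas_over M phi -> list_definable d0 M k satisfiable.
Proof.
move=> oM; have dphi := definable_psat oM.
pose g (i : 'I_k) (v : 'I_n + 'I_m) : 'I_n + 'I_k * 'I_m :=
  match v with inl x => inl x | inr j => inr (i, j) end.
have dall := @definable_all_in _ _ M _ _ (enum 'I_k)
  (fun i => [set a : 'I_n + 'I_k * 'I_m -> N | psat phi (a \o g i)])
  (fun i => definable_reindex (g i) dphi).
have := definable_existsn dall => dE; eexists; first exact: dE.
move=> pi sp /=; have E x (i : 'I_k) :
    pair_env x (tuple_env d0 pi) \o g i = pair_env x (nth d0 pi i : 'I_m -> N).
  by apply/funext => -[].
split=> -[x xP]; exists x.
  by move=> i _; rewrite /= E; apply: xP; rewrite mem_nth // sp.
move=> c cpi; have ilt : (index c pi < k)%N by rewrite -sp index_mem.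
have := xP (Ordinal ilt); rewrite mem_enum => /(_ isT) /=.
by rewrite E /= nth_index.
Qed.

(** Consistency is tested on finite sets of formulas, hence on finite lists of
    parameters. *)
Lemma consistent_satisfiable (s : nat -> A) k :
  consistent [set inst phi (s i : 'I_m -> N) | i in [set: nat]] -> satisfiable (latest s k).
Proof.
move=> cons; have [||x [_ xP]] := cons [set inst phi (s i : 'I_m -> N) | i in `I_k].
- exact/finite_image/finite_II.
- by move=> _ [i _ <-]; exists i.
exists x => c /mem_latest[i ilt ->]; apply/psat_inst; apply: xP; by exists i.
Qed.

Lemma satisfiable_consistent (I : eqType) (s : I -> A) (X : set I) :
  (forall r : seq I, {in r, forall i, X i} -> satisfiable [seq s i | i <- r]) ->
  consistent [set inst phi (s i : 'I_m -> N) | i in X].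
Proof.
move=> sats F Ffin FX.
have [fs fsF] := (@finite_seqP {classic (pformula N 'I_n)} F).1 Ffin.
have [r [rX rP]] : exists r : seq I, {in r, forall i, X i} /\
    {in fs, forall f, exists2 i, i \in r & f = inst phi (s i : 'I_m -> N)}.
  have {}FX : {in fs, forall f, exists2 i, X i & f = inst phi (s i : 'I_m -> N)}.
    by move=> f ffs; have [|i Xi <-] := FX f; [rewrite fsF|exists i].
  elim: fs {fsF} FX => [|f fs IH] FX; first by exists [::].
  have [|r [rX rP]] := IH; first by move=> g gfs; apply: FX; rewrite in_cons gfs orbT.
  have [i Xi fE] := FX f (mem_head _ _).
  exists (i :: r); split; first by move=> j; rewrite in_cons => /orP[/eqP ->|/rX].
  move=> g; rewrite in_cons => /orP[/eqP ->|/rP[j jr ->]]; first by exists i => //; exact: mem_head.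
  by exists j => //; rewrite in_cons jr orbT.
have [x xP] := sats r rX; exists x; split=> // f; rewrite fsF => /rP[i ir ->].
by apply/psat_inst/xP; exact: map_f.
Qed.

Lemma inconsistent_latest (s : nat -> A) :
  ~ consistent [set inst phi (s i : 'I_m -> N) | i in [set: nat]] ->
  exists k, forall k', (k <= k')%N -> ~ satisfiable (latest s k').
Proof.
move=> nc; apply: contrapT => nk; apply: nc; apply: satisfiable_consistent => r _.
have [k kP] : exists k, {in r, forall i, (i < k)%N}.
  by exists (\max_(i <- r) i.+1) => i ir; exact: leq_bigmax_seq.
apply: contrapT => ns; apply: nk; exists k => k' kk' sk'; apply: ns.
apply: satisfiable_sub sk' => c /mapP[i ir ->]; apply/mem_latest; exists i => //.
exact: leq_trans (kP _ ir) kk'.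
Qed.

End Instances.

Section Coheir.
Variables (L : signature) (N : structure L) (n m : nat).
Notation A := {classic ('I_m -> N)}.
Variable d0 : A.
Variables (K : Type) (M : set N).
Hypotheses (satN : saturated N K) (natK : card_lt [set: nat] K) (Msmall : card_lt M K).
Variable q : set_system ('I_m -> N).
Hypothesis qU : UltraFilter q.
Hypothesis qM : q [set c | forall j, M (c j)].

Definition entries (l : seq A) : set N := [set d | exists c j, c \in l /\ d = (c : 'I_m -> N) j].

Lemma finite_entries l : finite_set (entries l).
Proof.
elim: l => [|c l IH].
  by rewrite (_ : entries [::] = set0) //; apply/seteqP; split=> // d [c [j []]].
have -> : entries (c :: l) = range (c : 'I_m -> N) `|` entries l.
  apply/seteqP; split=> d.
    case=> c' [j []]; rewrite in_cons => /orP[/eqP ->|c'l] ->; first by left; exists j.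
    by right; exists c', j.
  case=> [[j _ <-]|[c' [j [c'l ->]]]]; first by exists c, j; rewrite mem_head.
  by exists c', j; rewrite in_cons c'l orbT.
by rewrite finite_setU; split=> //; exact/finite_image/finite_finset.
Qed.

Lemma sequence_choice (Q : seq A -> A -> Prop) : (forall l, exists y, Q l y) ->
  exists s : nat -> A, forall i, Q (latest s i) (s i).
Proof.
move=> /choice[f fQ].
pose l i := iter i (fun l => f l :: l) [::].
exists (fun i => f (l i)) => i; suff -> : latest (fun i => f (l i)) i = l i by [].
by elim: i => //= i ->.
Qed.

(** A Morley sequence of the coheir given by [q], in the monster model. *)
Lemma coheir_sequence : exists s : nat -> A, forall i D,
  definable (M `|` entries (latest s i)) D -> q D -> D (s i).
Proof.
apply: (@sequence_choice (fun l y => forall D, definable (M `|` entries l) D -> q D -> D y)).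
move=> l; have small := card_lt_setU_finite natK Msmall (finite_entries l).
exact: (@saturated_filter _ _ _ satN _ 'I_m q small).
Qed.

(** The global type given by an ultrafilter of tuples; it is a coheir over [M] as
    soon as the tuples of [M] are large. *)
Definition average_type : set (pformula N 'I_m) := [set f | q [set c | psat f c]].

Lemma average_finite (F : set (pformula N 'I_m)) : finite_set F -> F `<=` average_type ->
  q [set c | realizes c F].
Proof.
move=> Ffin Fq.
have [fs fsF] := (@finite_seqP {classic (pformula N 'I_m)} F).1 Ffin.
have : q [set c | {in fs, forall f : {classic (pformula N 'I_m)}, psat (f : pformula N 'I_m) c}].
  by apply: filter_all => f ffs; have : average_type f by apply: Fq; rewrite fsF.
by apply: filterS => c cP f; rewrite fsF => /cP.
Qed.

Lemma average_coheir : coheir_over M average_type.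
Proof.
move=> F Ffin Fq.
by have [c [cM cF]] := filterI_ex _ qM (average_finite Ffin Fq); exists c.
Qed.

Lemma average_global : global_type average_type.
Proof.
split=> //.
  by move=> F Ffin Fq; have /filter_ex[c cF] := average_finite Ffin Fq; exists c.
by move=> f _; exact: (in_ultra_setVsetC [set c | psat f c] qU).
Qed.

Variable s : nat -> A.
Hypothesis sP : forall i D, definable (M `|` entries (latest s i)) D -> q D -> D (s i).

Lemma average_morley : morley_seq_of M average_type (s : nat -> 'I_m -> N).
Proof.
move=> i f [qf oB]; apply: (sP (D := psat f)) => //.
apply: definable_psat => c /oB[Mc|[j [v [ji ->]]]]; [by left|right].
by exists (s j), v; split=> //; apply/mem_latest; exists j.
Qed.

(** The type over [M] of the Morley sequence is the iterated product of [q].  The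
    latest element is generic over the others, and can be replaced by almost
    every tuple of [M]; then it is a parameter from [M]. *)
Lemma average_product k C : list_definable d0 M k C -> C (latest s k) ->
  product (nseq k (q : set_system A)) C.
Proof.
elim: k C => [|k IH] C dC //= Cs.
have dz : definable (M `|` entries (latest s k)) [set z : 'I_m -> N | C ((z : A) :: latest s k)].
  apply: (list_definable_root (d0 := d0) (size_latest s k)).
    by move=> c j cl; right; exists c, j.
  by have [D dD H] := dC; exists D => //; apply: definableS dD => c; left.
have qz : q [set z : 'I_m -> N | C ((z : A) :: latest s k)].
  have [//|qn] := in_ultra_setVsetC [set z : 'I_m -> N | C ((z : A) :: latest s k)] qU.
  by have := sP (definable_not dz) qn.
apply: filterS (filterI qM qz) => z [zM Cz]; apply: IH => //.
exact: list_definable_param.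
Qed.

End Coheir.

(** * From antichain patterns to the antichain tree property *)

Section FreeVariables.
Variable L : signature.

Lemma finite_tvars V (t : term L V) : finite_set (tvars t).
Proof.
elim: t => [v|f ts IH] /=; first exact: finite_set1.
have -> : [set v | exists i, tvars (ts i) v] = \bigcup_(i in setT) tvars (ts i).
  by apply/seteqP; split=> v [i]; [exists i|move=> _; exists i].
by apply: bigcup_finite => //; exact: finite_finset.
Qed.

Lemma finite_fvars V (phi : formula L V) : finite_set (fvars phi).
Proof.
elim: phi => {V} [V|V s t|V r ts|V p IHp q IHq|V p IHp] //=.
- by rewrite finite_setU; split; exact: finite_tvars.
- have -> : [set v | exists i, tvars (ts i) v] = \bigcup_(i in setT) tvars (ts i).
    by apply/seteqP; split=> v [i]; [exists i|move=> _; exists i].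
  by apply: bigcup_finite => [|i _]; [exact: finite_finset|exact: finite_tvars].
- by rewrite finite_setU.
- by apply: (finite_preimage (f := Some)) => // x y _ _ [].
Qed.

(** A formula has finitely many parameters.  One more is added, because the parameters
    that do not occur have to be mapped somewhere. *)
Lemma extract_parameters (N : structure L) V (phi : pformula N V) :
  exists (r : nat) (c : 'I_r -> N) (phi0 : formula L (V + 'I_r)),
  forall a, psat phi a <-> sat phi0 (pair_env a c).
Proof.
have [d] := dom_inh N.
have Pfin : finite_set [set c : N | fvars phi (inr c)].
  by apply: (finite_preimage (f := inr)); [move=> x y _ _ []|exact: finite_fvars].
have [cs csP] := (@finite_seqP {classic N} [set c : N | fvars phi (inr c)]).1 Pfin.
pose g (v : V + N) : V + 'I_(size cs).+1 := match v with
  | inl v => inl v | inr c => inr (inord (index (c : {classic N}) cs)) end.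
exists (size cs).+1, (fun i => nth (d : {classic N}) cs i), (rename g phi) => a.
rewrite sat_rename; apply: sat_ext => -[v|c] //= pc.
have ccs : (c : {classic N}) \in cs by have : [set` cs] c by rewrite -csP.
by rewrite inordK ?nth_index // ltnS ltnW // index_mem.
Qed.

Fixpoint conj_seq V (fs : seq (formula L V)) : formula L V :=
  if fs is f :: fs' then Not (Imp f (Not (conj_seq fs'))) else Not Bot.

Lemma sat_conj_seq (N : structure L) V (I : eqType) (r : seq I)
    (f : I -> formula L V) (e : V -> N) :
  sat (conj_seq [seq f i | i <- r]) e <-> {in r, forall i, sat (f i) e}.
Proof.
elim: r => [|i r IH]; first by split=> //= _ [].
split=> [H j|H /=].
  have [Hi Hr] : sat (f i) e /\ sat (conj_seq [seq f i | i <- r]) e.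
    by split; apply: contrapT => nH; apply: H => // Hi Hr.
  by rewrite in_cons => /orP[/eqP ->//|jr]; exact: IH.1.
apply; first by apply: H; rewrite mem_head.
by apply/IH => j jr; apply: H; rewrite in_cons jr orbT.
Qed.

End FreeVariables.

Section Compactness.
Variables (L : signature) (N : structure L) (m : nat).
Notation A := {classic ('I_m -> N)}.
Variable d0 : A.
Variables (K : Type).
Hypotheses (satN : saturated N K) (natK : card_lt [set: nat] K).
Variable U : set_system nat.
Hypothesis UU : ProperFilter U.

(** The limit along an ultrafilter of sequences of tuples, realized one term at a time
    over the finitely many previous ones. *)
Lemma limit_sequence (E : nat -> nat -> A) : exists c : nat -> A,
  forall k C, list_definable d0 set0 k C -> U [set i | C (latest (E i) k)] -> C (latest c k).
Proof.
pose Inv (l : seq A) := forall C, list_definable d0 set0 (size l) C ->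
  U [set i | C (latest (E i) (size l))] -> C l.
have [l|c cP] := @sequence_choice L N m (fun l y => Inv l -> Inv (y :: l)).
  have [lI|] := EM (Inv l); last by exists d0.
  pose G : set_system ('I_m -> N) := [set X | exists C, [/\ list_definable d0 set0 (size l).+1 C,
    U [set i | C (latest (E i) (size l).+1)] & forall z : A, C (z :: l) -> X z]].
  have GP : ProperFilter G.
    split.
      move=> [C [dC UC CX]].
      have [z /CX//] : [set pi | exists z, C (z :: pi)] l.
      apply: lI; first exact: list_definable_exists.
      by apply: filterS UC => i Ci; exists (E i (size l)).
    split.
    - by exists setT; split=> //; [exact: list_definable_true|exact: filterT].
    - move=> X Y [C [dC UC CX]] [D [dD UD DY]]; exists (C `&` D); split.
      + exact: list_definable_and.
      + by apply: filterS (filterI UC UD).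
      + by move=> z [/CX ? /DY].
    - by move=> X Y XY [C [dC UC CX]]; exists C; split=> // z /CX/XY.
  have small := card_lt_setU_finite natK (card_lt_set0 N natK) (finite_entries l).
  have [y yP] := saturated_filter satN small GP.
  exists y => _ C dC UC; apply: (yP [set z : 'I_m -> N | C ((z : A) :: l)]).
    apply: (list_definable_root (d0 := d0) (n := size l)) => //.
      by move=> d j dl; right; exists d, j.
    by have [D dD H] := dC; exists D => //; apply: definableS dD; exact: sub0set.
  by exists C; split.
exists c; suff H k : Inv (latest c k) by move=> k C; have := H k C; rewrite size_latest.
elim: k => [|k IH]; last exact: cP.
by move=> C _ /filter_ex[].
Qed.

End Compactness.

Section Transfer.
Variables (L : signature) (N : structure L) (n m : nat).
Notation A := {classic ('I_m -> N)}.
Variable d0 : A.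
Variables (K : Type).
Hypotheses (satN : saturated N K) (natK : card_lt [set: nat] K).
Variable phi : pformula N ('I_n + 'I_m).

(** The formula with the antichain tree property is the conjunction of the instances of
    [phi] at the [s] entries of a tuple; the parameters of [phi] are appended to
    the tuples. *)
Lemma ATP_of_patterns s :
  (forall k, antichain_pattern (satisfiable phi) s k.+1) ->
  exists m' (psi : formula L ('I_n + 'I_m')), ATP N psi.
Proof.
move=> pat.
have [r [par [phi0 phi0E]]] := extract_parameters phi.
pose Y : finType := ('I_s * 'I_m + 'I_r)%type.
pose m' := #|Y|.
pose h (i : 'I_s) (v : 'I_n + 'I_m + 'I_r) : 'I_n + 'I_m' := match v with
  | inl (inl x) => inl x
  | inl (inr j) => inr (enum_rank (inl (i, j) : Y))
  | inr t => inr (enum_rank (inr t : Y)) end.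
pose psi := conj_seq [seq rename (h i) phi0 | i <- enum 'I_s].
pose B := {classic ('I_m' -> N)}.
pose enc (c : seq A) : B := fun t => match (enum_val t : Y) with
  | inl ij => (nth d0 c ij.1 : 'I_m -> N) ij.2 | inr t => par t end.
have encP (x : 'I_n -> N) c : size c = s ->
    psat (no_params N psi) (pair_env x (enc c : 'I_m' -> N)) <->
    {in c, forall e : A, psat phi (pair_env x (e : 'I_m -> N))}.
  move=> sc; rewrite /psat sat_rename sat_conj_seq.
  have E (i : 'I_s) : sat (rename (h i) phi0) (penv (pair_env x (enc c : 'I_m' -> N)) \o inl) <->
      psat phi (pair_env x (nth d0 c i : 'I_m -> N)).
    rewrite sat_rename phi0E.
    suff -> : (penv (pair_env x (enc c : 'I_m' -> N)) \o inl) \o h i =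
      pair_env (pair_env x (nth d0 c i : 'I_m -> N)) par by [].
    by apply/funext => -[[x'|j]|t] //=; rewrite /enc enum_rankK.
  split=> [H e ec|H i _].
    have ilt : (index e c < s)%N by rewrite -sc index_mem.
    have := H (Ordinal ilt); rewrite mem_enum => /(_ isT)/E.
    by rewrite /= nth_index.
  by apply/E; apply: H; apply: mem_nth; rewrite sc.
have psi0 : formulas_over set0 (no_params N psi).
  by move=> c; rewrite fvars_rename => -[].
have [U [UU evU]] := ultraFilterLemma eventually_filter.
have [b bP] : {b & forall k, [/\ forall w, size (b k w) = s,
    forall X, satisfiable phi (flatten [seq b k w | w <- antichain_words k.+1 X]) &
    forall u w, w <> [::] -> (size (u ++ w) < k.+1)%N ->
      ~ satisfiable phi (b k u ++ b k (u ++ w))]}.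
  by apply: (@choice _ _ (fun k b => [/\ forall w, size (b w) = s,
    forall X, satisfiable phi (flatten [seq b w | w <- antichain_words k.+1 X]) &
    forall u w, w <> [::] -> (size (u ++ w) < k.+1)%N ->
      ~ satisfiable phi (b u ++ b (u ++ w))])) => k; exact: pat.
pose word i : seq bool := odflt [::] (unpickle i).
have wordK w : word (pickle w) = w by rewrite /word pickleK.
pose e0 : B := enc [::].
have [c cP] := limit_sequence e0 satN natK (@ultra_proper _ _ UU) (fun k i => enc (b k (word i))).
have satE (ws : seq (seq bool)) k : satisfiable (no_params N psi) [seq enc (b k w) | w <- ws] <->
    satisfiable phi (flatten [seq b k w | w <- ws]).
  have [sb _ _] := bP k; split=> -[x xP]; exists x.
    move=> e /flattenP[_ /mapP[w wws ->]] eb.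
    by apply: (encP x (b k w) (sb w)).1 eb; apply: xP; exact: map_f.
  move=> _ /mapP[w wws ->]; apply/(encP _ _ (sb w)) => e eb; apply: xP.
  by apply/flattenP; exists (b k w) => //; exact: map_f.
(* conditions on finitely many nodes hold in the limit if they hold eventually *)
have transfer (ws : seq (seq bool)) (C : set (seq B)) :
    list_definable e0 set0 (size ws) C ->
    (exists k0, forall k, (k0 <= k)%N -> C [seq enc (b k w) | w <- ws]) ->
    C [seq c (pickle w) | w <- ws].
  move=> dC [k0 k0P].
  pose top := (\max_(w <- ws) (pickle w).+1)%N.
  have top_lt w : w \in ws -> (pickle w < top)%N by move=> wws; exact: leq_bigmax_seq.
  pose pos := [seq (top - (pickle w).+1)%N | w <- ws].
  have posE (s' : nat -> B) :
      [seq nth e0 (latest s' top) i | i <- pos] = [seq s' (pickle w) | w <- ws].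
    rewrite -map_comp; apply/eq_in_map => w /top_lt wlt /=.
    exact: nth_latest.
  have := cP top [set pi | C [seq nth e0 pi i | i <- pos]]; rewrite /= posE; apply.
    apply: list_definable_pick; last by rewrite size_map.
    by apply/allP => _ /mapP[w /top_lt wlt ->]; rewrite -subSn // subSS leq_subr.
  apply: evU; exists k0 => // k /= kk; rewrite posE.
  by under eq_map do rewrite wordK; exact: k0P.
exists m', psi, (fun w => c (pickle w)); split.
  move=> X antiX.
  apply: (@satisfiable_consistent _ _ _ _ (no_params N psi) _ (fun w => c (pickle w))).
  move=> ws wsX; apply: (transfer ws (satisfiable (no_params N psi))).
    exact: list_definable_satisfiable.
  exists (\max_(w <- ws) size w)%N => k kmax; apply/satE.
  have [_ sat_k _] := bP k.
  apply: satisfiable_sub (sat_k (mem ws)) => e /flattenP[_ /mapP[w wws ->] eb].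
  apply/flattenP; exists (b k w) => //; apply: map_f; apply: mem_antichain_words => //.
    move=> u v uws vws; apply: contraPeq => /eqP uv.
    exact/negP/(antiX u v (wsX _ uws) (wsX _ vws) uv).
  by rewrite ltnS; apply: leq_trans kmax; exact: leq_bigmax_seq.
move=> eta nu /prefixP[w ->] ew cons.
have w0 : w <> [::] by move=> w0; apply: ew; rewrite w0 cats0.
have : ~ satisfiable (no_params N psi) [seq c (pickle v) | v <- [:: eta; eta ++ w]].
  apply: (transfer [:: eta; eta ++ w] (~` (satisfiable (no_params N psi)))).
    exact/list_definable_not/list_definable_satisfiable.
  exists (size (eta ++ w)) => k ks; rewrite -[_ _]/(~ _) satE /= cats0.
  by have [_ _] := bP k; apply.
apply; have [||x [_ xP]] := cons [set inst (no_params N psi) (c (pickle eta) : 'I_m' -> N);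
    inst (no_params N psi) (c (pickle (eta ++ w)) : 'I_m' -> N)] => //.
exists x => e /mapP[v]; rewrite !inE => /orP[] /eqP -> ->; apply/psat_inst/xP; [by left|by right].
Qed.

End Transfer.

Theorem theorem3p10 (L : signature) (T : set (sentence L))
  (MM : structure L) (K : Type)
  (T_complete : complete_theory T)
  (MM_model : is_model MM T)
  (MM_monster : monster MM K)
  (T_NATP : NATP MM)
  (M : set MM)
  (M_elementary : elementary_submodel M)
  (M_small : card_lt M K)
  (n m : nat) (phi : pformula MM ('I_n + 'I_m))
  (phi_over_M : formulas_over M phi)
  (a : 'I_m -> MM) :
  Kim_divides M phi a -> coheir_divides M phi a.
Proof.
move=> [s [p [gp ap invp sp]] incons]; apply: contrapT => ncoheir.
have [natK _ satMM _] := MM_monster.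
pose d0 : {classic ('I_m -> MM)} := a.
pose s' : nat -> {classic ('I_m -> MM)} := s.
have filters := chain_type_filters d0 (s := s') satMM M_small M_elementary gp invp sp.
have [||k kP] := @antichain_patterns _ (satisfiable phi)
  (@satisfiable_sub _ _ _ _ phi) _ filters.
- have [k kP] := inconsistent_latest (s := s') incons.
  exists k => k' kk'; exists (~` satisfiable phi); split=> //; last exact: kP.
  exact/list_definable_not/list_definable_satisfiable.
- move=> q qU qP k.
  have qM : q [set c : 'I_m -> MM | forall j, M (c j)].
    have : q [set z | [set pi | in_model M pi] [:: z]].
      by apply: qP; exists setT; split=> //; exact: list_definable_true.
    by apply: filterS => z zM j; apply: zM; rewrite inE.
  have [r rP] := coheir_sequence satMM natK M_small qU.
  have ra : tp a M `<=` average_type q.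
    move=> f [oB fa]; have pf : p f by apply: ap.
    have : q [set z | [set pi | psat f (nth d0 pi 0 : 'I_m -> MM)] [:: z]].
      apply: qP; exists [set pi | psat f (nth d0 pi 0 : 'I_m -> MM)]; split=> //.
        pose g (j : 'I_m) : 'I_1 * 'I_m := (ord0, j).
        exists [set x : 'I_1 * 'I_m -> MM | psat f (x \o g)] => //.
        exact: (definable_reindex g (definable_psat oB)).
      by apply: (sp 0); split=> // c /oB; left.
    by [].
  apply: (average_product (d0 := d0) qU qM rP); first exact: list_definable_satisfiable.
  apply: consistent_satisfiable; apply: contrapT => nc; apply: ncoheir.
  exists r => //; exists (average_type q); split=> //.
  + exact: average_global.
  + exact: average_coheir.
  + exact: average_morley.
have [m' [psi]] := ATP_of_patterns d0 satMM natK kP.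
exact: T_NATP.
Qed.
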